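(* Let $n,q\in\mathbb{Z}_{\ge3}$ with $\mathsf{K}^{(q)}\le\mathsf{K}^{(n)}$. Then the reduction homomorphism $$ \mathcal{R}_{\mathsf{K}^{(q)},\mathsf{K}^{(n)}}:\mathsf{GT}(\mathsf{K}^{(q)})\to\mathsf{GT}(\mathsf{K}^{(n)}) $$ is surjective.
   Context: **Braid groups.** $\mathrm{B}_3=\langle \sigma_1,\sigma_2\mid \sigma_1\sigma_2\sigma_1=\sigma_2\sigma_1\sigma_2\rangle$; $\mathrm{PB}_3$ is the kernel of the standard homomorphism $\mathrm{B}_3\to S_3$; $x_{12}:=\sigma_1^2$, $x_{23}:=\sigma_2^2$, $c:=(\sigma_1\sigma_2\sigma_1)^2$. One has $\mathrm{PB}_3=\langle x_{12},x_{23}\rangle\times\langle c\rangle$ with $\langle x_{12},x_{23}\rangle$ free; $\mathsf{F}_2$ denotes the subgroup $\langle x_{12},x_{23}\rangle$, with $x:=x_{12}$, $y:=x_{23}$. $\mathsf{NFI}_{\mathrm{PB}_3}(\mathrm{B}_3)$ is the set of finite index normal subgroups $\mathsf{N}\unlhd\mathrm{B}_3$ with $\mathsf{N}\le\mathrm{PB}_3$. For such $\mathsf{N}$: $\mathsf{N}_{\mathsf{F}_2}:=\mathsf{N}\cap\mathsf{F}_2$, and $N_{\mathrm{ord}}$ is the lcm of the orders of $x_{12}\mathsf{N}$, $x_{23}\mathsf{N}$, $c\mathsf{N}$ in $\mathrm{PB}_3/\mathsf{N}$. **$\mathsf{GT}$-shadows.** For $(m,f)\in\mathbb{Z}\times\mathsf{F}_2$,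 $[m,f]:=(m+N_{\mathrm{ord}}\mathbb{Z}, f\mathsf{N}_{\mathsf{F}_2})$. $\mathsf{GT}(\mathsf{N})$ is the set of those $[m,f]\in\mathbb{Z}/N_{\mathrm{ord}}\mathbb{Z}\times\mathsf{F}_2/\mathsf{N}_{\mathsf{F}_2}$ such that: (i) the hexagon relations hold: $\sigma_1^{2m+1}f^{-1}\sigma_2^{2m+1}f\,\mathsf{N}=f^{-1}\sigma_1\sigma_2x_{12}^{-m}c^m\,\mathsf{N}$ and $f^{-1}\sigma_2^{2m+1}f\sigma_1^{2m+1}\,\mathsf{N}=\sigma_2\sigma_1x_{23}^{-m}c^mf\,\mathsf{N}$; (ii) $\gcd(2m+1,N_{\mathrm{ord}})=1$ and $f\mathsf{N}_{\mathsf{F}_2}\in[\mathsf{F}_2/\mathsf{N}_{\mathsf{F}_2},\mathsf{F}_2/\mathsf{N}_{\mathsf{F}_2}]$; (iii) the homomorphism $T_{m,f}:\mathrm{B}_3\to\mathrm{B}_3/\mathsf{N}$, $\sigma_1\mapsto\sigma_1^{2m+1}\mathsf{N}$, $\sigma_2\mapsto f^{-1}\sigma_2^{2m+1}f\,\mathsf{N}$ (well defined by (i)), is surjective. $\mathsf{N}$ is called isolated if $\ker T_{m,f}=\mathsf{N}$ for all $[m,f]\in\mathsf{GT}(\mathsf{N})$; then $\mathsf{GT}(\mathsf{N})$ is a finite group under $[m_1,f_1]\circ[m_2,f_2]=[2m_1m_2+m_1+m_2,\ f_1E_{m_1,f_1}(f_2)]$, where $E_{m,f}\in\mathrm{End}(\mathsf{F}_2)$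 is given by $x\mapsto x^{2m+1}$, $y\mapsto f^{-1}y^{2m+1}f$. For $\mathsf{H}\le\mathsf{N}$ in $\mathsf{NFI}_{\mathrm{PB}_3}(\mathrm{B}_3)$, the reduction map $\mathcal{R}_{\mathsf{H},\mathsf{N}}:\mathsf{GT}(\mathsf{H})\to\mathsf{GT}(\mathsf{N})$ sends the class of $(m,f)$ to the class of the same pair $(m,f)$; it is well defined, and it is a group homomorphism if $\mathsf{H},\mathsf{N}$ are isolated. **The subgroups $\mathsf{K}^{(n)}$.** For an integer $n\ge3$ let $D_n=\langle r,s\mid r^n,s^2,srs^{-1}r\rangle$, and let $\psi_n:\mathrm{PB}_3\to D_n^3$ be the homomorphism $\psi_n(x_{12})=(r,s,s)$, $\psi_n(x_{23})=(rs,r,rs)$, $\psi_n(c)=(1,1,1)$. Set $\mathsf{K}^{(n)}:=\ker\psi_n$. It is a fact that $\mathsf{K}^{(n)}\in\mathsf{NFI}_{\mathrm{PB}_3}(\mathrm{B}_3)$ and that it is isolated, so $\mathsf{GT}(\mathsf{K}^{(n)})$ is a finite group. *)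

(* Defs.v *)
From HB Require Import structures.
From mathcomp Require Import all_boot all_order all_algebra all_fingroup.
From mathcomp Require Import boolp classical_sets functions.
Set Implicit Arguments.
Unset Strict Implicit.
Unset Printing Implicit Defensive.
Import GroupScope.
Local Open Scope classical_set_scope.
Local Open Scope group_scope.

(* [generated one mul inv S]: the subgroup generated by S, for a group given by
   bare operations, so that it also applies to groups whose elements are
   cosets, represented as sets. *)
Inductive generated (T : Type) (one : T) (mul : T -> T -> T) (inv : T -> T)
    (S : set T) : set T :=
  | generated_in x of S x : generated one mul inv S x
  | generated1 : generated one mul inv S one
  | generatedM x y of generated one mul inv S x & generated one mul inv S y :
      generated one mul inv S (mul x y)
  | generatedV x of generated one mul inv S x : generated one mul inv S (inv x).

(* The letter (x, false) stands for x, and (x, true) for x^-1; the pair (u, v)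
   in R stands for the relation u = v. *)
Inductive word_equiv (X : choiceType) (R : seq (seq (X * bool) * seq (X * bool)))
    : seq (X * bool) -> seq (X * bool) -> Prop :=
  | word_equiv_refl u : word_equiv R u u
  | word_equiv_sym u v of word_equiv R u v : word_equiv R v u
  | word_equiv_trans u v w of word_equiv R u v & word_equiv R v w :
      word_equiv R u w
  | word_equiv_cat u u' v v' of word_equiv R u u' & word_equiv R v v' :
      word_equiv R (u ++ v) (u' ++ v')
  | word_equiv_cancel x b : word_equiv R [:: (x, b); (x, ~~ b)] [::]
  | word_equiv_rel u v of (u, v) \in R : word_equiv R u v.

Section Presented.
Context (X : choiceType) (R : seq (seq (X * bool) * seq (X * bool))).

Local Notation word := (seq (X * bool)).

Definition word_equivb : rel word := fun u v => `[< word_equiv R u v >].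

Lemma word_equivb_refl : reflexive word_equivb.
Proof. by move=> u; apply/asboolP; exact: word_equiv_refl. Qed.

Lemma word_equivb_sym : symmetric word_equivb.
Proof.
by move=> u v; apply/asboolP/asboolP => h; exact: word_equiv_sym.
Qed.

Lemma word_equivb_trans : transitive word_equivb.
Proof.
move=> u v w /asboolP h1 /asboolP h2; apply/asboolP.
exact: word_equiv_trans h1 h2.
Qed.

Canonical word_equiv_rel_canonical :=
  EquivRel word_equivb word_equivb_refl word_equivb_sym word_equivb_trans.

Definition presented := {eq_quot word_equivb}%qT.
HB.instance Definition _ := Choice.on presented.

Definition word_inv (u : word) : word := rev [seq (l.1, ~~ l.2) | l <- u].

Definition pres_mk (u : word) : presented := (\pi_presented u)%qT.
Definition pres_mul (g h : presented) := pres_mk (generic_quotient.repr g ++ generic_quotient.repr h).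
Definition pres_inv (g : presented) := pres_mk (word_inv (generic_quotient.repr g)).
Definition gen (x : X) : presented := pres_mk [:: (x, false)].

Lemma pres_mkP u v : pres_mk u = pres_mk v <-> word_equiv R u v.
Proof.
split=> [/eqmodP /asboolP //|h]; apply/eqmodP; exact/asboolP.
Qed.

Lemma pres_reprK g : pres_mk (generic_quotient.repr g) = g.
Proof. exact: reprK. Qed.

Lemma repr_mk u : word_equiv R (generic_quotient.repr (pres_mk u)) u.
Proof. by apply/pres_mkP; rewrite pres_reprK. Qed.

Lemma pres_mk_cat u v : pres_mul (pres_mk u) (pres_mk v) = pres_mk (u ++ v).
Proof. by apply/pres_mkP; apply: word_equiv_cat; exact: repr_mk. Qed.

Lemma word_inv_cat u v : word_inv (u ++ v) = word_inv v ++ word_inv u.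
Proof. by rewrite /word_inv map_cat rev_cat. Qed.

Lemma word_invK : involutive word_inv.
Proof.
move=> u; rewrite /word_inv map_rev revK -map_comp map_id_in // => -[x b] _ /=.
by rewrite negbK.
Qed.

Lemma word_mulV u : word_equiv R (u ++ word_inv u) [::].
Proof.
elim: u => [|[x b] u IH]; first exact: word_equiv_refl.
rewrite -cat1s word_inv_cat catA -(catA _ u).
apply: word_equiv_trans (word_equiv_cancel R x b).
rewrite -[X in word_equiv R _ X]/([:: (x, b)] ++ [::] ++ [:: (x, ~~ b)]) -catA.
apply: word_equiv_cat; first exact: word_equiv_refl.
by apply: word_equiv_cat => //; exact: word_equiv_refl.
Qed.

Lemma word_mulV' u : word_equiv R (word_inv u ++ u) [::].
Proof. by have := word_mulV (word_inv u); rewrite word_invK. Qed.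

Lemma pres_mulA : associative pres_mul.
Proof.
move=> f g h; rewrite -(pres_reprK f) -(pres_reprK g) -(pres_reprK h).
by rewrite !pres_mk_cat catA.
Qed.

Lemma pres_mul1 : left_id (pres_mk [::]) pres_mul.
Proof. by move=> g; rewrite -(pres_reprK g) pres_mk_cat. Qed.

Lemma pres_1mul : right_id (pres_mk [::]) pres_mul.
Proof. by move=> g; rewrite -(pres_reprK g) pres_mk_cat cats0. Qed.

Lemma pres_mulV : left_inverse (pres_mk [::]) pres_inv pres_mul.
Proof.
move=> g; rewrite -{2}(pres_reprK g) pres_mk_cat; apply/pres_mkP.
exact: word_mulV'.
Qed.

Lemma pres_Vmul : right_inverse (pres_mk [::]) pres_inv pres_mul.
Proof.
move=> g; rewrite -{1}(pres_reprK g) pres_mk_cat; apply/pres_mkP.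
exact: word_mulV.
Qed.

HB.instance Definition _ := isGroup.Build presented
  pres_mulA pres_mul1 pres_1mul pres_mulV pres_Vmul.

Lemma pres_mkM u v : pres_mk (u ++ v) = pres_mk u * pres_mk v.
Proof. by rewrite -pres_mk_cat. Qed.

Section Lift.
Context (G : groupType) (f : X -> G).

Definition word_eval (u : word) : G :=
  foldr (fun l g => (if l.2 then (f l.1)^-1 else f l.1) * g) 1 u.

Definition pres_lift (g : presented) : G := word_eval (generic_quotient.repr g).

Lemma word_eval_cat u v : word_eval (u ++ v) = word_eval u * word_eval v.
Proof. by elim: u => [|l u IH] /=; rewrite ?mul1g // IH mulgA. Qed.

Hypothesis fR : forall u v, (u, v) \in R -> word_eval u = word_eval v.

Lemma word_eval_equiv u v : word_equiv R u v -> word_eval u = word_eval v.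
Proof.
elim=> {u v} //.
- by move=> u v w _ -> _ ->.
- by move=> u u' v v' _ hu _ hv; rewrite !word_eval_cat hu hv.
- by move=> x [] /=; rewrite mulg1 ?mulVg ?mulgV.
Qed.

Lemma pres_lift_mk u : pres_lift (pres_mk u) = word_eval u.
Proof. by apply: word_eval_equiv; exact: repr_mk. Qed.

Lemma pres_liftM : {morph pres_lift : g h / g * h}.
Proof.
by move=> g h; rewrite -[g * h]/(pres_mk (_ ++ _)) pres_lift_mk word_eval_cat.
Qed.

Lemma pres_lift_gen x : pres_lift (gen x) = f x.
Proof. by rewrite pres_lift_mk /= mulg1. Qed.

End Lift.
End Presented.

(* false indexes sigma_1 and true indexes sigma_2. *)
Definition B3_rel : seq (seq (bool * bool) * seq (bool * bool)) :=
  [:: ([:: (false, false); (true, false); (false, false)],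
       [:: (true, false); (false, false); (true, false)])].

Definition B3 : groupType := presented B3_rel.

Definition s1 : B3 := gen B3_rel false.
Definition s2 : B3 := gen B3_rel true.

Definition sigma_perm (i : bool) : 'S_3 :=
  if i then tperm (inord 1) (inord 2) else tperm (inord 0) (inord 1).
Arguments sigma_perm : simpl never.

Definition B3_to_S3 : B3 -> 'S_3 := pres_lift sigma_perm.

Definition PB3 : set B3 := [set g | B3_to_S3 g = 1].

Definition x12 : B3 := s1 ^+ 2.
Definition x23 : B3 := s2 ^+ 2.
Definition c : B3 := (s1 * s2 * s1) ^+ 2.

Definition F2 : set B3 :=
  generated 1 (fun g h => g * h) (fun g => g^-1) [set x12; x23].

(* Elements of a quotient H/N are represented by the cosets gN, as sets; the
   operations below are the group operations of H/N when N is normal in H. *)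

Section Cosets.
Context (G : groupType).
Implicit Types (N H A B : set G).

Definition left_coset (g : G) N : set G := [set g * h | h in N].
Definition coset_mul A B : set G := [set a * b | a in A & b in B].
Definition coset_inv A : set G := [set a^-1 | a in A].
Definition coset_comm A B : set G :=
  coset_mul (coset_mul A B) (coset_mul (coset_inv A) (coset_inv B)).

Definition quotient_set H N : set (set G) := [set left_coset g N | g in H].

Definition quotient_derived H N : set (set G) :=
  generated N coset_mul coset_inv
    [set coset_comm A B | A in quotient_set H N & B in quotient_set H N].

(* The order of gN, with value 0 if it is infinite. *)
Definition coset_order (g : G) N : nat :=
  if pselect (exists k, (0 < k)%N && `[< left_coset (g ^+ k) N = N >]) is left ex
  then ex_minn ex else 0.

Definition zpow (g : G) (k : int) : G :=
  match k with Posz k => g ^+ k | Negz k => g ^- k.+1 end.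

End Cosets.

(* N is meant to be a finite index normal subgroup of B3 contained in PB3. *)

Section GTShadows.
Implicit Types (N : set B3) (m : int) (f : B3).

Definition NF2 N : set B3 := N `&` F2.

Definition Nord N : nat :=
  lcmn (lcmn (coset_order x12 N) (coset_order x23 N)) (coset_order c N).

Definition residue_class m (d : nat) : set int :=
  [set (m + d%:Z * j)%R | j in [set: int]].

(* The class [m, f] in Z/N_ord x F_2/N_{F_2}. *)
Definition GTclass N m f : set int * set B3 :=
  (residue_class m (Nord N), left_coset f (NF2 N)).

Definition hexagons N m f : Prop :=
  let e := (2 * m + 1)%R in
  left_coset (zpow s1 e * f^-1 * zpow s2 e * f) N =
    left_coset (f^-1 * s1 * s2 * zpow x12 (- m)%R * zpow c m) N /\
  left_coset (f^-1 * zpow s2 e * f * zpow s1 e) N =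
    left_coset (s2 * s1 * zpow x23 (- m)%R * zpow c m * f) N.

(* T is a homomorphism B_3 -> B_3/N; the hexagons make it exist and it is
   unique, as s1 and s2 generate B_3. *)
Definition is_T N m f (T : B3 -> set B3) : Prop :=
  let e := (2 * m + 1)%R in
  [/\ forall g, quotient_set [set: B3] N (T g),
      forall g h, T (g * h) = coset_mul (T g) (T h),
      T s1 = left_coset (zpow s1 e) N &
      T s2 = left_coset (f^-1 * zpow s2 e * f) N].

Definition is_GT_pair N m f : Prop :=
  [/\ F2 f,
      hexagons N m f,
      coprimez (2 * m + 1)%R (Nord N)%:Z,
      quotient_derived F2 (NF2 N) (left_coset f (NF2 N)) &
      exists2 T, is_T N m f T &
        set_surj [set: B3] (quotient_set [set: B3] N) T].

Definition GT N : set (set int * set B3) :=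
  [set P | exists m f, is_GT_pair N m f /\ P = GTclass N m f].

(* The reduction map with target GT(N): a coset of a smaller subgroup is sent
   to the coset of N_ord Z, resp. N_{F_2}, that contains it. *)
Definition reduction N (P : set int * set B3) : set int * set B3 :=
  ([set (a + b)%R | a in P.1 & b in residue_class 0%R (Nord N)],
   coset_mul P.2 (NF2 N)).

End GTShadows.

(* false indexes r and true indexes s. *)
Definition dihedral_rel (n : nat) : seq (seq (bool * bool) * seq (bool * bool)) :=
  [:: (nseq n (false, false), [::]);
      ([:: (true, false); (true, false)], [::]);
      ([:: (true, false); (false, false); (true, true); (false, false)], [::])].

Definition dihedral (n : nat) : groupType := presented (dihedral_rel n).
Definition dr n : dihedral n := gen (dihedral_rel n) false.
Definition ds n : dihedral n := gen (dihedral_rel n) true.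

Definition dihedral3 n : groupType :=
  (dihedral n * dihedral n * dihedral n)%type.

(* The values of psi outside PB3 are irrelevant. *)
Definition is_psi n (psi : B3 -> dihedral3 n) : Prop :=
  [/\ forall g h, PB3 g -> PB3 h -> psi (g * h) = psi g * psi h,
      psi x12 = (dr n, ds n, ds n),
      psi x23 = (dr n * ds n, dr n, dr n * ds n) &
      psi c = 1].

(* Existence of psi: for all a and b in a group G there is a homomorphism
   PB3 -> G with x12 |-> a, x23 |-> b and c |-> 1. It is read off from the right
   action of B3 on the product of a Schreier transversal of PB3 with G. *)
Section PureBraidHom.

Variant transversal := Te | T1 | T2 | T12 | T21 | T121.

Definition tstep (i : bool) (t : transversal) : transversal :=
  match t, i with
  | Te, false => T1 | Te, true => T2
  | T1, false => Te | T1, true => T12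
  | T2, false => T21 | T2, true => Te
  | T12, false => T121 | T12, true => T1
  | T21, false => T2 | T21, true => T121
  | T121, false => T12 | T121, true => T21
  end.

Definition tperm3 (t : transversal) : 'S_3 :=
  let a := sigma_perm false in let b := sigma_perm true in
  match t with
  | Te => 1 | T1 => a | T2 => b | T12 => a * b | T21 => b * a
  | T121 => a * b * a
  end.

Lemma inord3E :
  ((inord 0 = @Ordinal 3 0 isT) * (inord 1 = @Ordinal 3 1 isT)
    * (inord 2 = @Ordinal 3 2 isT))%type.
Proof. by split; [split|]; apply: val_inj; rewrite /= inordK. Qed.

Lemma sigma_perm_braid :
  sigma_perm false * sigma_perm true * sigma_perm false =
  sigma_perm true * sigma_perm false * sigma_perm true.
Proof.
apply/permP => i; rewrite /sigma_perm !inord3E !permM !permE /=.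
by case: i => -[|[|[|]]].
Qed.

Lemma sigma_perm_sqr i : sigma_perm i * sigma_perm i = 1.
Proof. by case: i; rewrite /sigma_perm tperm2. Qed.

Lemma B3_to_S3_rel u v : (u, v) \in B3_rel ->
  word_eval sigma_perm u = word_eval sigma_perm v.
Proof.
rewrite inE => /eqP[-> ->]; rewrite /word_eval /= !mulg1 !mulgA.
exact: sigma_perm_braid.
Qed.

Lemma tperm3_step i t : tperm3 (tstep i t) = tperm3 t * sigma_perm i.
Proof.
have sq j x : x * sigma_perm j * sigma_perm j = x :> 'S_3.
  by rewrite -mulgA sigma_perm_sqr mulg1.
case: i t => -[] /=; rewrite ?mul1g ?sigma_perm_sqr ?sq //;
by rewrite sigma_perm_braid ?sq.
Qed.

Lemma tstepK i : involutive (tstep i).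
Proof. by case: i => -[]. Qed.

Lemma tperm3_eq1 t : tperm3 t = 1 -> t = Te.
Proof.
move=> /permP h; have := h (inord 0); have := h (inord 1).
by case: t {h}; rewrite //= /sigma_perm !inord3E !permE /= ?permE /= ?permE /=.
Qed.

Context (G : groupType) (a b : G).

Definition tweight (i : bool) (t : transversal) : G :=
  match t, i with
  | T1, false => a
  | T2, true => b
  | T12, true => b^-1 * a^-1
  | T21, false => a^-1 * b^-1
  | T121, false => b
  | T121, true => a
  | _, _ => 1
  end.

Definition letter_act (p : transversal * G) (l : bool * bool) : transversal * G :=
  (tstep l.1 p.1,
   p.2 * if l.2 then (tweight l.1 (tstep l.1 p.1))^-1 else tweight l.1 p.1).

Definition word_act := foldl letter_act.

Lemma word_act_equiv u v p :
  word_equiv B3_rel u v -> word_act p u = word_act p v.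
Proof.
move=> h; elim: h p => {u v} //.
- by move=> u v w _ h1 _ h2 p; rewrite h1.
- by move=> u u' v v' _ h1 _ h2 p; rewrite /word_act !foldl_cat -!/(word_act _ _) h1 h2.
- move=> x [] [t g]; rewrite /= /letter_act /= tstepK -mulgA ?mulVg ?mulgV ?mulg1 //.
- move=> u v; rewrite inE => /eqP[-> ->] [t g].
  rewrite /= /letter_act /=; case: t => /=; rewrite -!mulgA; congr (_, _ * _);
    by rewrite ?mulg1 ?mul1g ?mulgA ?mulgV ?mulVg ?mul1g ?mulgK ?mulgKV
         ?mulgV ?mulVg ?mulg1.
Qed.

Lemma word_act_translate t g u :
  word_act (t, g) u = ((word_act (t, 1) u).1, g * (word_act (t, 1) u).2).
Proof.
elim/last_ind: u => [|u l IH]; first by rewrite /= mulg1.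
by rewrite /word_act !foldl_rcons -!/(word_act _ _) IH /letter_act /= mulgA.
Qed.

Lemma word_act_perm p u :
  tperm3 (word_act p u).1 = tperm3 p.1 * word_eval sigma_perm u.
Proof.
elim: u p => [|[x e] u IH] p; first by rewrite /= mulg1.
rewrite /= IH /= tperm3_step mulgA; congr (_ * _ * _).
by case: e => //; apply: (mulgI (sigma_perm x)); rewrite mulgV sigma_perm_sqr.
Qed.

Definition schreier_hom (g : B3) : G :=
  (word_act (Te, 1) (generic_quotient.repr g)).2.

Lemma schreier_hom_mk u : schreier_hom (pres_mk B3_rel u) = (word_act (Te, 1) u).2.
Proof.
by rewrite /schreier_hom (word_act_equiv _ (repr_mk B3_rel u)).
Qed.

Lemma schreier_homM g h : PB3 g ->
  schreier_hom (g * h) = schreier_hom g * schreier_hom h.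
Proof.
move=> /= Pg.
rewrite -[in LHS](pres_reprK g) -[in LHS](pres_reprK h) -pres_mkM schreier_hom_mk.
rewrite /word_act foldl_cat -!/(word_act _ _).
rewrite [word_act _ (generic_quotient.repr g)]surjective_pairing.
rewrite word_act_translate /=.
suff -> : (word_act (Te, 1) (generic_quotient.repr g)).1 = Te by [].
by apply: tperm3_eq1; rewrite word_act_perm /= mul1g.
Qed.

Lemma schreier_hom_values :
  [/\ schreier_hom x12 = a, schreier_hom x23 = b & schreier_hom c = 1].
Proof.
pose l i : seq (bool * bool) := [:: (i, false)].
pose d := l false ++ l true ++ l false.
have x12E : x12 = pres_mk B3_rel (l false ++ l false) by rewrite pres_mkM.
have x23E : x23 = pres_mk B3_rel (l true ++ l true) by rewrite pres_mkM.
have cE : c = pres_mk B3_rel (d ++ d) 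
  by rewrite /d !pres_mkM /c expg2 !mulgA.
rewrite x12E x23E cE !schreier_hom_mk /word_act /=.
by rewrite !mul1g mulgA mulgV mul1g mulVg.
Qed.

End PureBraidHom.

Lemma psi_exists n : exists psi, @is_psi n psi.
Proof.
exists (@schreier_hom (dihedral3 n) (dr n, ds n, ds n)
  (dr n * ds n, dr n, dr n * ds n)).
have [h1 h2 h3] := @schreier_hom_values (dihedral3 n) (dr n, ds n, ds n)
  (dr n * ds n, dr n, dr n * ds n).
by split => // g h Pg _; exact: schreier_homM.
Qed.

Definition psi n : B3 -> dihedral3 n := projT1 (cid (psi_exists n)).

Lemma psiP n : is_psi (@psi n).
Proof. exact: projT2 (cid (psi_exists n)). Qed.

Definition K (n : nat) : set B3 := [set g | PB3 g /\ psi n g = 1].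

Definition is_subgroup (G : groupType) (N : set G) : Prop :=
  [/\ N 1, forall g h, N g -> N h -> N (g * h) & forall g, N g -> N g^-1].

Section ReductionClass.

Lemma left_coset_id (G : groupType) (N : set G) g :
  is_subgroup N -> left_coset g N = N <-> N g.
Proof.
move=> [N1 NM NV]; split=> [<-|Ng]; first by exists 1; rewrite ?mulg1.
apply/seteqP; split=> [_ [h Nh <-]|h Nh]; first exact: NM.
by exists (g^-1 * h); [apply: NM => //; exact: NV | rewrite mulVKg].
Qed.

Lemma subgroupX (G : groupType) (N : set G) g k :
  is_subgroup N -> N g -> N (g ^+ k).
Proof.
by move=> [N1 NM _] Ng; elim: k => [|k IH] //; rewrite expgS; exact: NM.
Qed.

Lemma coset_order_dvd (G : groupType) (N : set G) g k :
  is_subgroup N -> N (g ^+ k) -> coset_order g N %| k.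
Proof.
move=> sN; case: k => [|k] Ng; first by rewrite dvdn0.
rewrite /coset_order; case: pselect => [ex|[]]; last first.
  by exists k.+1 => /=; apply/asboolP/(left_coset_id _ sN).
case: ex_minnP => d /andP[d0 /asboolP/(left_coset_id _ sN) Nd] dmin.
rewrite /dvdn; case: (posnP (k.+1 %% d)) => [//|r0].
suff : d <= k.+1 %% d by rewrite leqNgt ltn_pmod.
apply: dmin; rewrite r0; apply/asboolP/(left_coset_id _ sN).
have -> : g ^+ (k.+1 %% d) = (g ^+ d ^+ (k.+1 %/ d))^-1 * g ^+ k.+1.
  by rewrite {3}(divn_eq k.+1 d) expgnDr mulnC expgnA mulKg.
by case: (sN) => _ NM NV; apply: NM => //; apply: NV; exact: subgroupX.
Qed.

Lemma coset_order_sub (G : groupType) (H N : set G) g :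
  is_subgroup H -> is_subgroup N -> H `<=` N ->
  coset_order g N %| coset_order g H.
Proof.
move=> sH sN HN; rewrite {2}/coset_order; case: pselect => [ex|_]; last first.
  exact: dvdn0.
case: ex_minnP => d /andP[_ /asboolP/(left_coset_id _ sH)/HN Nd] _.
exact: coset_order_dvd.
Qed.

Lemma is_subgroup_NF2 (N : set B3) : is_subgroup N -> is_subgroup (NF2 N).
Proof.
move=> [N1 NM NV]; split.
- by split=> //; exact: generated1.
- by move=> g h [Ng Fg] [Nh Fh]; split; [exact: NM | exact: (generatedM Fg Fh)].
- by move=> g [Ng Fg]; split; [exact: NV | exact: (generatedV Fg)].
Qed.

Lemma reduction_class (H N : set B3) (m : int) (f : B3) :
  is_subgroup H -> is_subgroup N -> H `<=` N ->
  reduction N (GTclass H m f) = GTclass N m f.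
Proof.
move=> sH sN HN; congr (_, _) => /=.
  have /dvdnP[q qE] : Nord N %| Nord H.
    rewrite /Nord !dvdn_lcm; have ord g := coset_order_sub g sH sN HN.
    apply/andP; split; last exact: dvdn_trans (ord c) (dvdn_lcmr _ _).
    apply/andP; split.
      apply: dvdn_trans (ord x12) _.
      exact: dvdn_trans (dvdn_lcml _ _) (dvdn_lcml _ _).
    apply: dvdn_trans (ord x23) _.
    exact: dvdn_trans (dvdn_lcmr _ _) (dvdn_lcml _ _).
  apply/seteqP; split=> [_ [_ [i _ <-] [_ [j _ <-] <-]]|_ [j _ <-]].
    exists (q%:Z * i + j)%R => //.
    rewrite qE PoszM GRing.add0r GRing.mulrDr GRing.addrA; congr (_ + _ + _)%R.
    by rewrite -GRing.mulrA GRing.mulrCA.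
  exists m; first by exists 0%R; rewrite ?GRing.mulr0 ?GRing.addr0.
  by exists ((Nord N)%:Z * j)%R => //; exists j => //; rewrite GRing.add0r.
have [H1 _ _] := is_subgroup_NF2 sH; have [N1 NM _] := is_subgroup_NF2 sN.
apply/seteqP; split=> [_ [_ [h [Hh Fh] <-] [k Nk <-]]|_ [k Nk <-]].
  exists (h * k); last by rewrite mulgA.
  by apply: NM => //; split => //; exact: HN.
by exists f; [exists 1; rewrite ?mulg1 | exists k].
Qed.

Lemma B3_to_S3M : {morph B3_to_S3 : g h / g * h}.
Proof. exact: pres_liftM B3_to_S3_rel. Qed.

Lemma B3_to_S31 : B3_to_S3 1 = 1.
Proof. by apply: (mulgI (B3_to_S3 1)); rewrite -B3_to_S3M !mulg1. Qed.

Lemma is_subgroup_K n : is_subgroup (K n).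
Proof.
have [psiM _ _ _] := psiP n.
have PB1 : PB3 1 by exact: B3_to_S31.
have PBV g : PB3 g -> PB3 g^-1.
  move=> /= Pg; apply: (mulgI (B3_to_S3 g)).
  by rewrite -B3_to_S3M mulgV B3_to_S31 Pg mulg1.
have psi1 : psi n 1 = 1.
  by apply: (mulgI (psi n 1)); rewrite -psiM // !mulg1.
split=> // [g h [Pg eg] [Ph eh]|g [Pg eg]]; split.
- by rewrite /PB3 /= B3_to_S3M Pg Ph mulg1.
- by rewrite psiM // eg eh mulg1.
- exact: PBV.
- have := psiM _ _ Pg (PBV _ Pg); rewrite mulgV psi1 eg mul1g.
  by move=> ->.
Qed.

End ReductionClass.

(* Main.v *)
(* K^(n) is the kernel of an action Psi of the whole group B_3 on (Z/2n)^3 by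
   signed permutations of the coordinates composed with translations; on PB_3
   the action is diagonal and its three coordinates are those of psi_n, with D_n
   acting on Z/2n by r : v |-> v + 2 and s : v |-> - v. An element f of F_2 whose
   class is in the derived subgroup acts by a translation (4a, 4b, 4d) with a, b,
   d of the same parity, and the hexagon relations for (m, f) mean that 4b = -4a
   and 4d = 4 kappa(m) modulo 2n, where kappa(m) = - m/2 or (m + 1)/2 according to
   the parity of m. Conversely every such pair with 2m + 1 prime to n is a
   GT-shadow. Hence a shadow (m, f) of K^(n) lifts to K^(q): change m by a
   multiple of 2n so that 2m + 1 becomes prime to q, add kappa(m) - d to a, which
   makes a and kappa(m) of the same parity, and realize the integral translation
   (4a, -4a, 4 kappa(m)) by a product of powers of two commutators of F_2. *)
Require Import Defs.
From mathcomp Require Import all_boot all_order all_algebra all_fingroup.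
From mathcomp Require Import boolp classical_sets functions.
From mathcomp Require Import ring zify.
Set Implicit Arguments.
Unset Strict Implicit.
Unset Printing Implicit Defensive.
Import GroupScope.
Local Open Scope classical_set_scope.
Local Open Scope group_scope.

(** * Integer powers in a group *)

Section IntegerPowers.
Context (G : groupType).
Implicit Types (g h : G) (i j : int).

Lemma zpowSr g i : zpow g (i + 1)%R = zpow g i * g.
Proof.
case: i => [k|[|k]]; first by rewrite -PoszD addn1 /= expgSr.
  by rewrite /= expg1 mulVg.
have -> : (Negz k.+1 + 1 = Negz k)%R by lia.
by rewrite /= [in RHS]expgS invgM -mulgA mulVg mulg1.
Qed.

(** Going down, the step is inverted by cancelling [g], so the upward recurrence is enough. Closed
    formulas for [zpow] are checked through it. *)
Lemma zpow_uniq g (p : int -> G) :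
  p 0%R = 1 -> (forall i, p (i + 1)%R = p i * g) -> forall i, zpow g i = p i.
Proof.
move=> p0 pS; elim/int_rec => [//|k IH|k IH].
  by rewrite intS GRing.addrC zpowSr pS IH.
apply: (mulIg g); rewrite -zpowSr -pS.
by have -> : (- k.+1%:Z + 1 = - k%:Z)%R by lia.
Qed.

Lemma zpowD g i j : zpow g (i + j)%R = zpow g i * zpow g j.
Proof.
apply: (mulgI (zpow g i)^-1); rewrite mulKg; apply/esym.
apply: (zpow_uniq (p := fun j => (zpow g i)^-1 * zpow g (i + j)%R)).
  by rewrite GRing.addr0 mulVg.
by move=> k; rewrite GRing.addrA zpowSr mulgA.
Qed.

Lemma zpowM g i j : zpow g (i * j)%R = zpow (zpow g i) j.
Proof.
apply/esym; apply: (zpow_uniq (p := fun j => zpow g (i * j)%R)).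
  by rewrite GRing.mulr0.
by move=> k; rewrite GRing.mulrDr GRing.mulr1 zpowD.
Qed.

Lemma zpow_subgroup (S : set G) g i : is_subgroup S -> S g -> S (zpow g i).
Proof.
move=> sS Sg; have [_ _ SV] := sS.
by case: i => k; last apply: SV; exact: subgroupX.
Qed.

End IntegerPowers.

Lemma zpow_morph (G H : groupType) (phi : G -> H) g i :
  {morph phi : x y / x * y} -> phi (zpow g i) = zpow (phi g) i.
Proof.
move=> phiM; apply/esym.
apply: (zpow_uniq (p := fun i => phi (zpow g i))) => [|j].
  by apply: (mulgI (phi 1)); rewrite -phiM !mulg1.
by rewrite zpowSr phiM.
Qed.

(** * Affine permutations of a ring and the action of the braid generators on triples *)

Section AffineAction.
Context (R : finComNzRingType).

(** The ring stays arbitrary because a single braid is later evaluated both over [Z/2n] and over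
    [Z/2q]. *)
Definition affine_fun (e : bool) (k v : R) : R := ((-1) ^+ e * v + k)%R.

Lemma affine_fun_inj e k : injective (affine_fun e k).
Proof.
move=> u v /GRing.addIr; case: e; rewrite ?GRing.expr0 ?GRing.expr1.
  by rewrite !GRing.mulN1r => /GRing.oppr_inj.
by rewrite !GRing.mul1r.
Qed.

Definition affine e k : {perm R} := perm (affine_fun_inj (e := e) (k := k)).

(** Products of permutations act from left to right, so the second sign also hits the first
    translation. *)
Lemma affineM e k e' k' :
  affine e k * affine e' k' = affine (e (+) e') ((-1) ^+ e' * k + k')%R.
Proof.
apply/permP => v; rewrite permM !permE /affine_fun.
by case: e e' => -[] /=; ring.
Qed.

Lemma affine1 : affine false 0%R = 1.
Proof. by apply/permP => v; rewrite !permE /affine_fun; ring. Qed.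

Lemma affineV e k : (affine e k)^-1 = affine e (- ((-1) ^+ e * k))%R.
Proof.
apply: (mulgI (affine e k)); rewrite mulgV affineM -affine1 addbb.
by congr (affine _ _); case: e => /=; ring.
Qed.

Local Notation V := (R * R * R)%type.
Implicit Types (p q : {perm R}).

Definition perm3_fun p1 p2 p3 (v : V) : V := (p1 v.1.1, p2 v.1.2, p3 v.2).

Lemma perm3_fun_inj p1 p2 p3 : injective (perm3_fun p1 p2 p3).
Proof.
by move=> [[a b] c] [[a' b'] c'] [] /perm_inj-> /perm_inj-> /perm_inj->.
Qed.

Definition perm3 p1 p2 p3 : {perm V} :=
  perm (perm3_fun_inj (p1 := p1) (p2 := p2) (p3 := p3)).

Lemma perm3M p1 p2 p3 q1 q2 q3 :
  perm3 p1 p2 p3 * perm3 q1 q2 q3 = perm3 (p1 * q1) (p2 * q2) (p3 * q3).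
Proof. by apply/permP => v; rewrite permM !permE /perm3_fun /= !permM. Qed.

Lemma perm3_1 : perm3 1 1 1 = 1.
Proof. by apply/permP => -[[a b] c]; rewrite !permE /perm3_fun /= !perm1. Qed.

Lemma perm3V p1 p2 p3 : (perm3 p1 p2 p3)^-1 = perm3 p1^-1 p2^-1 p3^-1.
Proof.
by apply: (mulgI (perm3 p1 p2 p3)); rewrite perm3M !mulgV perm3_1.
Qed.

Lemma perm3_inj p1 p2 p3 q1 q2 q3 : perm3 p1 p2 p3 = perm3 q1 q2 q3 ->
  [/\ p1 = q1, p2 = q2 & p3 = q3].
Proof.
move=> /permP e; split; apply/permP => v.
- by have := e (v, v, v); rewrite !permE => -[].
- by have := e (v, v, v); rewrite !permE => -[].
- by have := e (v, v, v); rewrite !permE => -[].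
Qed.

Definition shift (a b c : R) : {perm V} :=
  perm3 (affine false a) (affine false b) (affine false c).

Lemma shiftE a b c v : shift a b c v = (v.1.1 + a, v.1.2 + b, v.2 + c)%R.
Proof.
by rewrite permE /perm3_fun !permE /affine_fun !GRing.expr0 !GRing.mul1r.
Qed.

Lemma shiftM a b c a' b' c' :
  shift a b c * shift a' b' c' = shift (a + a')%R (b + b')%R (c + c')%R.
Proof. by rewrite perm3M !affineM !GRing.expr0 !GRing.mul1r. Qed.

Lemma shift0 : shift 0%R 0%R 0%R = 1.
Proof. by rewrite /shift affine1 perm3_1. Qed.

Lemma shiftV a b c : (shift a b c)^-1 = shift (- a)%R (- b)%R (- c)%R.
Proof.
by apply: (mulgI (shift a b c)); rewrite mulgV shiftM !GRing.addrN shift0.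
Qed.

Lemma zpow_shift a b c i :
  zpow (shift a b c) i = shift (a * i%:~R)%R (b * i%:~R)%R (c * i%:~R)%R.
Proof.
apply: (zpow_uniq (p := fun i : int => shift (a * i%:~R)%R (b * i%:~R)%R (c * i%:~R)%R)).
  by rewrite !GRing.mulr0 shift0.
by move=> j; rewrite shiftM; congr shift; ring.
Qed.

(* Their squares are diag(r, s, s) and diag(r s, r, r s), in the dihedral action
   r : v |-> v + 2, s : v |-> - v, where r s is r followed by s. *)
Definition act1_fun (v : V) : V := (v.1.1 + 1, v.2, - v.1.2)%R.
Definition act2_fun (v : V) : V := (- v.2 - 2, v.1.2 + 1, v.1.1)%R.

Lemma act1_fun_inj : injective act1_fun.
Proof.
move=> [[a b] c] [[a' b'] c'] [] /GRing.addIr-> /= ->.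
by move=> /GRing.oppr_inj->.
Qed.

Lemma act2_fun_inj : injective act2_fun.
Proof.
move=> [[a b] c] [[a' b'] c'] [] /GRing.addIr /= /GRing.oppr_inj->.
by move=> /GRing.addIr-> ->.
Qed.

Definition act1 := perm act1_fun_inj.
Definition act2 := perm act2_fun_inj.

Lemma act_braid : act1 * act2 * act1 = act2 * act1 * act2.
Proof.
apply/permP => -[[a b] c]; rewrite !permM !permE /act1_fun /act2_fun /=.
by congr (_, _, _); ring.
Qed.

End AffineAction.

(** * Presented groups and the universal property of [B3] *)

Lemma is_subgroup_gen (G : groupType) (S : set G) :
  is_subgroup (Defs.generated 1 (fun g h => g * h) (fun g => g^-1) S).
Proof.
split; [exact: generated1 | exact: generatedM | exact: generatedV].
Qed.

Notation sigma := (gen B3_rel).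

Lemma braid : s1 * s2 * s1 = s2 * s1 * s2.
Proof.
have /pres_mkP := @word_equiv_rel _ B3_rel _ _ (mem_head _ _).
by rewrite -![[:: _, _ & _]]cat1s !pres_mkM -!mulgA.
Qed.

Lemma pres_mk_inv_gen (X : choiceType) (r : seq (seq (X * bool) * seq (X * bool))) x :
  pres_mk r [:: (x, true)] = (gen r x)^-1.
Proof.
apply: (mulgI (gen r x)); rewrite mulgV -pres_mkM.
by apply/pres_mkP; exact: word_equiv_cancel.
Qed.

Lemma pres_ind (X : choiceType) (r : seq (seq (X * bool) * seq (X * bool)))
    (P : presented r -> Prop) :
  P 1 -> (forall g x, P g -> P (g * gen r x)) ->
  (forall g x, P g -> P (g * (gen r x)^-1)) -> forall g, P g.
Proof.
move=> P1 PM PV g; rewrite -(pres_reprK g).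
elim/last_ind: (generic_quotient.repr g) => [//|u [x e] IH].
rewrite -cats1 pres_mkM; case: e; last exact: PM.
by rewrite pres_mk_inv_gen; exact: PV.
Qed.

Lemma B3_gen (S : set B3) : is_subgroup S -> S s1 -> S s2 -> forall g, S g.
Proof.
move=> [S1 SM SV] Ss1 Ss2.
have Ss i : S (sigma i) by case: i.
by apply: pres_ind => // g i Sg; apply: SM => //; exact: SV.
Qed.

Section BraidLift.
Context (G : groupType) (a b : G) (ab : a * b * a = b * a * b).

Let ab_fun (i : bool) := if i then b else a.

Definition braid_lift : B3 -> G := pres_lift ab_fun.

Let ab_rel u v : (u, v) \in B3_rel -> word_eval ab_fun u = word_eval ab_fun v.
Proof.
by rewrite inE => /eqP[-> ->]; rewrite /word_eval /= !mulg1 !mulgA.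
Qed.

Lemma braid_liftM : {morph braid_lift : g h / g * h}.
Proof. exact: pres_liftM ab_rel. Qed.

Lemma braid_lift_s1 : braid_lift s1 = a.
Proof. exact: (pres_lift_gen ab_rel). Qed.

Lemma braid_lift_s2 : braid_lift s2 = b.
Proof. exact: (pres_lift_gen ab_rel). Qed.

End BraidLift.

Lemma morph_one (G H : groupType) (phi : G -> H) :
  {morph phi : x y / x * y} -> phi 1 = 1.
Proof. by move=> phiM; apply: (mulgI (phi 1)); rewrite -phiM !mulg1. Qed.

Lemma morph_inv (G H : groupType) (phi : G -> H) g :
  {morph phi : x y / x * y} -> phi g^-1 = (phi g)^-1.
Proof.
by move=> phiM; apply: (mulgI (phi g)); rewrite -phiM !mulgV morph_one.
Qed.

(** * Schreier generators of the pure braid group *)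

Section PureGenerators.

Definition pure_gen : set B3 :=
  Defs.generated 1 (fun g h => g * h) (fun g => g^-1) [set x12; x23; c].

Let x12P : pure_gen x12. Proof. by apply: generated_in; left; left. Qed.
Let x23P : pure_gen x23. Proof. by apply: generated_in; left; right. Qed.
Let cP : pure_gen c. Proof. by apply: generated_in; right. Qed.

Definition tbraid (t : Defs.transversal) : B3 :=
  match t with
  | Te => 1 | T1 => s1 | T2 => s2 | T12 => s1 * s2 | T21 => s2 * s1
  | T121 => s1 * s2 * s1
  end.

Lemma B3_to_S3_tbraid t : B3_to_S3 (tbraid t) = tperm3 t.
Proof.
have e i : B3_to_S3 (sigma i) = sigma_perm i by exact: (pres_lift_gen B3_to_S3_rel).
by case: t; rewrite /= ?B3_to_S3M ?B3_to_S31 ?e.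
Qed.

Lemma c_alt : c = s1 * s2 * s1 * s2 * s1 * s2.
Proof. by rewrite /c expg2 {2}braid !mulgA. Qed.

Lemma c_alt' : c = s2 * s1 * s2 * s1 * s2 * s1.
Proof. by rewrite /c expg2 {1}braid !mulgA. Qed.

Let cancel_tail (u v w z : B3) : w * v^-1 * u^-1 * z * (z^-1 * u * v) = w.
Proof. by rewrite !mulgA mulgK !mulgVK. Qed.

(** After right multiplication by [s1^-1 * x12 * x23] both sides become [c], the left one by a
    single braid relation. *)
Lemma s1_conj_x23 : s1 * s2 * s2 = c * x23^-1 * x12^-1 * s1.
Proof.
apply: (mulIg (s1^-1 * x12 * x23)); rewrite cancel_tail c_alt /x12 /x23 !expg2.
rewrite !mulgA mulgVK -!mulgA; congr (_ * (_ * _)).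
by rewrite !mulgA -braid.
Qed.

Lemma s2_conj_x12 : s2 * s1 * s1 = c * x12^-1 * x23^-1 * s2.
Proof.
apply: (mulIg (s2^-1 * x23 * x12)); rewrite cancel_tail c_alt' /x12 /x23 !expg2.
rewrite !mulgA mulgVK -!mulgA; congr (_ * (_ * _)).
by rewrite !mulgA braid.
Qed.

(** Schreier rewriting: most products are representatives already or give one square. The hard cases
    [s1 * s2 * s2] and [s2 * s1 * s1] are the two conjugation formulas. *)
Lemma tbraid_step t i :
  exists2 p, pure_gen p & tbraid t * sigma i = p * tbraid (tstep i t).
Proof.
have [one mul inv] := is_subgroup_gen [set x12; x23; c].
case: i; change (sigma true) with s2; change (sigma false) with s1; case: t => /=.
- by exists 1; rewrite ?mul1g.
- by exists 1; rewrite ?mul1g.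
- by exists x23; rewrite ?mulg1 // -expg2.
- exists (c * x23^-1 * x12^-1); last exact: s1_conj_x23.
  by apply: (mul); [apply: (mul) => //|]; apply: (inv).
- by exists 1; rewrite ?mul1g // braid.
- exists x12 => //; rewrite /x12 expg2 -!mulgA; congr (_ * _).
  by rewrite !mulgA -braid.
- by exists 1; rewrite ?mul1g.
- by exists x12; rewrite ?mulg1 // -expg2.
- by exists 1; rewrite ?mul1g.
- by exists 1; rewrite ?mul1g.
- exists (c * x12^-1 * x23^-1); last exact: s2_conj_x12.
  by apply: (mul); [apply: (mul) => //|]; apply: (inv).
- exists x23 => //; rewrite /x23 expg2 braid -!mulgA; congr (_ * _).
  by rewrite !mulgA braid.
Qed.

Lemma tbraid_decomp g : exists t, exists2 p, pure_gen p & g = p * tbraid t.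
Proof.
have [one mul inv] := is_subgroup_gen [set x12; x23; c].
elim/pres_ind: g => [|g i [t [p Pp ->]]|g i [t [p Pp ->]]].
- by exists Te, 1; rewrite ?mulg1.
- have [w Pw e] := tbraid_step t i; exists (tstep i t), (p * w); first exact: mul.
  by rewrite -mulgA e mulgA.
(* An inverse letter uses the step out of [tstep i t], which leads back to [t] since [tstep i] is an
   involution. *)
- have [w Pw] := tbraid_step (tstep i t) i; rewrite tstepK => e.
  exists (tstep i t), (p * w^-1); first by apply: mul => //; exact: inv.
  by rewrite -mulgA -[tbraid t](mulKg w) -e !mulgA mulgK.
Qed.

Let sqr_pure t : tperm3 t * tperm3 t = 1 -> PB3 (tbraid t ^+ 2).
Proof. by move=> e; rewrite /PB3 /mkset expg2 B3_to_S3M !B3_to_S3_tbraid. Qed.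

Lemma x12_pure : PB3 x12.
Proof. by apply: (@sqr_pure T1); rewrite /= sigma_perm_sqr. Qed.

Lemma x23_pure : PB3 x23.
Proof. by apply: (@sqr_pure T2); rewrite /= sigma_perm_sqr. Qed.

Lemma c_pure : PB3 c.
Proof.
apply: (@sqr_pure T121).
have sq i (g : 'S_3) : g * sigma_perm i * sigma_perm i = g.
  by rewrite -mulgA sigma_perm_sqr mulg1.
by rewrite /= !mulgA !sq sigma_perm_sqr.
Qed.

Lemma is_subgroup_PB3 : is_subgroup PB3.
Proof.
split=> [|g h Pg Ph|g Pg]; rewrite /PB3 /=.
- exact: B3_to_S31.
- by rewrite B3_to_S3M Pg Ph mulg1.
- by rewrite (morph_inv _ B3_to_S3M) Pg invg1.
Qed.

(** A pure braid is an element of [pure_gen] times a representative. The latter then has trivial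
    permutation, which forces it to be [1]. *)
Lemma pure_genP : pure_gen = PB3.
Proof.
have [one mul inv] := is_subgroup_PB3.
have sub g : pure_gen g -> PB3 g.
  elim=> {g} [g [[->|->]|->]|||].
  - exact: x12_pure. - exact: x23_pure. - exact: c_pure. - exact: one.
  - by move=> g h _ Pg _; exact: mul.
  - by move=> g _; exact: inv.
apply/seteqP; split=> // g Pg; have [t [p Pp gE]] := tbraid_decomp g.
suff tE : t = Te by rewrite gE tE mulg1.
apply: tperm3_eq1; rewrite -B3_to_S3_tbraid.
by rewrite -[tbraid t](mulKg p) -gE B3_to_S3M (morph_inv _ B3_to_S3M) Pg (sub _ Pp) invg1 mulg1.
Qed.

End PureGenerators.

(** * The dihedral groups and their faithful action on [Z/2n] *)

Section DihedralAction.
Context (R : finComNzRingType) (n : nat).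

Lemma affine_expn (k : R) j : affine false k ^+ j = affine false (k * j%:R)%R.
Proof.
elim: j => [|j IH]; first by rewrite GRing.mulr0 affine1.
by rewrite expgSr IH affineM /=; congr (affine _ _); ring.
Qed.

Lemma zpow_affine (k : R) i : zpow (affine false k) i = affine false (k * i%:~R)%R.
Proof.
apply: (zpow_uniq (p := fun i : int => affine false (k * i%:~R)%R)).
  by rewrite GRing.mulr0 affine1.
by move=> j; rewrite affineM /=; congr (affine _ _); ring.
Qed.

Definition dihedral_act_gen (i : bool) : {perm R} :=
  if i then affine true 0%R else affine false 2%R.

Definition dihedral_act : dihedral n -> {perm R} := pres_lift dihedral_act_gen.

Hypothesis n2R : (2 * n%:R = 0 :> R)%R.

Lemma dihedral_act_rel u v : (u, v) \in dihedral_rel n ->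
  word_eval dihedral_act_gen u = word_eval dihedral_act_gen v.
Proof.
have rn j : word_eval dihedral_act_gen (nseq j (false, false)) = affine false 2%R ^+ j.
  by elim: j => [//|j IH]; rewrite expgS -IH.
rewrite !inE => /or3P[] /eqP[-> ->].
- by rewrite rn affine_expn n2R affine1.
- by rewrite /word_eval /= mulg1 affineM -affine1; congr (affine _ _); ring.
- rewrite /word_eval /= mulg1 !affineV !affineM -affine1.
  by congr (affine _ _); ring.
Qed.

Lemma dihedral_actM : {morph dihedral_act : g h / g * h}.
Proof. exact: pres_liftM dihedral_act_rel. Qed.

Lemma dihedral_act_r : dihedral_act (dr n) = affine false 2%R.
Proof. exact: (pres_lift_gen dihedral_act_rel false). Qed.

Lemma dihedral_act_s : dihedral_act (ds n) = affine true 0%R.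
Proof. exact: (pres_lift_gen dihedral_act_rel true). Qed.

End DihedralAction.

Section DihedralNormalForm.
Context (n : nat).
Local Notation r := (dr n).
Local Notation s := (ds n).

Lemma dihedral_rn : r ^+ n = 1.
Proof.
have /pres_mkP := @word_equiv_rel _ (dihedral_rel n) _ _ (mem_head _ _).
suff -> j : pres_mk (dihedral_rel n) (nseq j (false, false)) = r ^+ j by [].
by elim: j => [|j IH] //; rewrite expgS -IH -pres_mkM.
Qed.

Lemma dihedral_ss : s * s = 1.
Proof.
have /word_equiv_rel/pres_mkP e :
    ([:: (true, false); (true, false)], [::]) \in dihedral_rel n.
  by rewrite !inE eqxx orbT.
by move: e; rewrite -cat1s pres_mkM.
Qed.

Lemma dihedral_sr : s * r = r^-1 * s.
Proof.
have /word_equiv_rel/pres_mkP e :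
    ([:: (true, false); (false, false); (true, true); (false, false)], [::])
      \in dihedral_rel n.
  by rewrite !inE eqxx !orbT.
have {}e : s * r * s^-1 * r = 1.
  by rewrite -[RHS]e -![[:: _, _ & _]]cat1s !pres_mkM pres_mk_inv_gen !mulgA.
by apply: (mulIg (s^-1 * r)); rewrite !mulgA e mulgK mulVg.
Qed.

Lemma dihedral_normal_form (d : dihedral n) :
  exists (i : int) (b : bool), d = zpow r i * s ^+ b.
Proof.
have sV : s^-1 = s by apply: (mulgI s); rewrite mulgV dihedral_ss.
have srV : s * r^-1 = r * s.
  by apply: (mulIg r); rewrite mulgVK -mulgA dihedral_sr mulgA mulgV mul1g.
have zV i : zpow r i * r^-1 = zpow r (i - 1)%R by rewrite zpowD.
elim/pres_ind: d => [|g x [i [b ->]]|g x [i [b ->]]].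
- by exists 0%R, false; rewrite mulg1.
- case: x; first exists i, (~~ b).
    rewrite -mulgA; case: b; rewrite ?expg0 ?expg1 ?mul1g //.
    by rewrite dihedral_ss.
  case: b; first exists (i - 1)%R, true.
    by rewrite expg1 -mulgA dihedral_sr mulgA zV.
  by exists (i + 1)%R, false; rewrite zpowSr !mulg1.
- case: x; first exists i, (~~ b).
    rewrite -[(gen _ true)^-1]/(s^-1) sV.
    rewrite -mulgA; case: b; rewrite ?expg0 ?expg1 ?mul1g //.
    by rewrite dihedral_ss.
  case: b; first exists (i + 1)%R, true.
    by rewrite expg1 -mulgA srV mulgA zpowSr.
  by exists (i - 1)%R, false; rewrite -zV !mulg1.
Qed.

End DihedralNormalForm.

Lemma Zp_intr_eq0 k (i : int) : (1 < k)%N ->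
  (i%:~R == 0 :> 'Z_k)%R = (k %| i)%Z.
Proof.
move=> k1; have nat0 j : (j%:R == 0 :> 'Z_k)%R = (k %| j)%N.
  by rewrite -[LHS]/(nat_of_ord (j%:R%R : 'Z_k) == 0%N) val_Zp_nat.
case: i => j; first by rewrite -[j%:~R%R]/(j%:R)%R nat0.
by rewrite NegzE GRing.rmorphN GRing.oppr_eq0 nat0 /= dvdzE abszN.
Qed.

(** The values at 0 and 1 decide: if [r^i s] acted trivially, then [2 = 0] in [Z/2n], impossible for
    [n > 1]; if [r^i] does, then [2 n] divides [2 i]. *)
Lemma dihedral_act_inj n : (1 < n)%N ->
  forall d, @dihedral_act 'Z_(2 * n) n d = 1 -> d = 1.
Proof.
move=> n1 d; have k1 : (1 < 2 * n)%N by lia.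
have n2R : (2 * n%:R = 0 :> 'Z_(2 * n))%R.
  by rewrite -GRing.natrM; apply/eqP; rewrite (Zp_intr_eq0 (Posz _)).
have actM := dihedral_actM n2R.
have [i [b ->]] := dihedral_normal_form d.
rewrite actM zpow_morph // dihedral_act_r // zpow_affine => /permP act.
have {}act v := act v; move: act.
have -> : dihedral_act 'Z_(2 * n) (ds n ^+ b) = affine b 0%R.
  by case: b; rewrite ?expg1 ?dihedral_act_s // expg0 morph_one ?affine1.
move=> act; have := act 0%R; have := act 1%R.
rewrite affineM /= !permE /affine_fun.
case: b act => _ /=; rewrite ?GRing.expr0 ?GRing.expr1 => e1 e0.
  have /eqP : ((2 : int)%:~R = 0 :> 'Z_(2 * n))%R.
    transitivity (1 - (-1 * 1 + (-1 * (2 * i%:~R) + 0)) +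
      (-1 * 0 + (-1 * (2 * i%:~R) + 0)) : 'Z_(2 * n))%R; first by ring.
    by rewrite e1 e0; ring.
  by rewrite Zp_intr_eq0 // dvdzE /= => /dvdn_leq; lia.
have /eqP : ((2 * i)%:~R = 0 :> 'Z_(2 * n))%R by rewrite -[RHS]e0; ring.
rewrite Zp_intr_eq0 // => /dvdzP[j ij].
have -> : i = (n%:Z * j)%R by lia.
rewrite mulg1 zpowM /= dihedral_rn; apply: (zpow_uniq (p := fun=> 1)) => //.
by move=> l; rewrite mulg1.
Qed.

(** * The action [Psi] of the braid group and its kernel *)

Section Psi.
Context (R : finComNzRingType).

Definition Psi : B3 -> {perm R * R * R} := braid_lift (act1 R) (act2 R).

Lemma PsiM : {morph Psi : g h / g * h}.
Proof. exact: braid_liftM (act_braid R). Qed.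

Lemma Psi_s1 : Psi s1 = act1 R.
Proof. exact: braid_lift_s1 (act_braid R). Qed.

Lemma Psi_s2 : Psi s2 = act2 R.
Proof. exact: braid_lift_s2 (act_braid R). Qed.

Lemma PsiV g : Psi g^-1 = (Psi g)^-1.
Proof. exact: morph_inv PsiM. Qed.

Lemma Psi1 : Psi 1 = 1.
Proof. exact: morph_one PsiM. Qed.

Lemma Psi_zpow g i : Psi (zpow g i) = zpow (Psi g) i.
Proof. exact: zpow_morph PsiM. Qed.

Lemma Psi_x12 :
  Psi x12 = perm3 (affine false 2%R) (affine true 0%R) (affine true 0%R).
Proof.
rewrite /x12 expg2 PsiM Psi_s1; apply/permP => -[[a b] c].
rewrite permM !permE /perm3_fun /= !permE /act1_fun /affine_fun /=.
by congr (_, _, _); ring.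
Qed.

Lemma Psi_x23 :
  Psi x23 = perm3 (affine true (- 2)%R) (affine false 2%R) (affine true (- 2)%R).
Proof.
rewrite /x23 expg2 PsiM Psi_s2; apply/permP => -[[a b] c].
rewrite permM !permE /perm3_fun /= !permE /act2_fun /affine_fun /=.
by congr (_, _, _); ring.
Qed.

Lemma Psi_c : Psi c = 1.
Proof.
rewrite /c expg2 !PsiM Psi_s1 Psi_s2; apply/permP => -[[a b] c].
rewrite !permM !permE /act1_fun /act2_fun /=.
by congr (_, _, _); ring.
Qed.

(** Both sides are multiplicative on [PB3] and agree on its generators [x12], [x23] and [c]. *)
Lemma Psi_psi n g : (2 * n%:R = 0 :> R)%R -> PB3 g ->
  Psi g = perm3 (dihedral_act R (psi n g).1.1) (dihedral_act R (psi n g).1.2)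
    (dihedral_act R (psi n g).2).
Proof.
move=> n2R; have [psiM psi12 psi23 psic] := psiP n.
have [PB1 PBM PBV] := is_subgroup_PB3; have actM := dihedral_actM n2R.
have psi1 : psi n 1 = 1 by apply: (mulgI (psi n 1)); rewrite -psiM // !mulg1.
have one : perm3 (dihedral_act R (1 : dihedral3 n).1.1)
    (dihedral_act R (1 : dihedral3 n).1.2) (dihedral_act R (1 : dihedral3 n).2) = 1.
  by rewrite /= !(morph_one actM) perm3_1.
have sub h : pure_gen h -> PB3 h by rewrite pure_genP.
rewrite -pure_genP; elim=> {g} [g|||].
- case=> [[]|] ->.
  + by rewrite psi12 Psi_x12 /= dihedral_act_r // dihedral_act_s.
  + rewrite psi23 Psi_x23 /= actM dihedral_act_r // dihedral_act_s // affineM.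
    by congr (perm3 (affine _ _) _ (affine _ _)) => /=; ring.
  + by rewrite psic Psi_c one.
- by rewrite psi1 one Psi1.
- move=> g h /sub Pg IHg /sub Ph IHh.
  by rewrite PsiM psiM // IHg IHh perm3M /= !actM.
- move=> g /sub Pg IHg; rewrite PsiV IHg perm3V.
  have -> : psi n g^-1 = (psi n g)^-1.
    by apply: (mulgI (psi n g)); rewrite -psiM ?mulgV ?psi1 //; exact: PBV.
  by rewrite /= !(morph_inv _ actM).
Qed.

End Psi.

(** A nontrivial representative permutes the coordinates, so it cannot act on each of them
    separately. This detects purity from [Psi]. *)
Lemma tbraid_diag (R : finComNzRingType) t (p1 p2 p3 : {perm R}) :
  Psi R (tbraid t) = perm3 p1 p2 p3 -> t = Te.
Proof.
move=> e; have absurd (x y : R) : x = y -> (x - y = 1)%R -> False.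
  by move=> ->; rewrite GRing.subrr => /esym/eqP; rewrite GRing.oner_eq0.
have d2 (v w : R * R * R) : v.1.2 = w.1.2 ->
    (Psi R (tbraid t) v).1.2 = (Psi R (tbraid t) w).1.2.
  by move=> vw; rewrite e !permE /= vw.
have d3 (v w : R * R * R) : v.2 = w.2 ->
    (Psi R (tbraid t) v).2 = (Psi R (tbraid t) w).2.
  by move=> vw; rewrite e !permE /= vw.
pose o : R * R * R := (0, 0, 0)%R.
(* For every [t] other than [Te], one of these three comparisons changes only the coordinate that
   [tbraid t] moves to the observed place, and the two observed values differ by 1. *)
have {}d2 := (absurd _ _ (d2 (0, 0, 1)%R o erefl), absurd _ _ (d2 (1, 0, 0)%R o erefl)).
have {}d3 := absurd _ _ (d3 (1, 0, 0)%R o erefl).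
case: t {e} d2 d3 => //= -[d2 d2'] d3; exfalso; [move: d2|move: d3|move: d3|move: d2'|move: d2'];
  rewrite ?PsiM ?Psi_s1 ?Psi_s2 ?permM !permE /act1_fun /act2_fun /=; apply; ring.
Qed.

(** On pure braids [Psi] is [psi n] followed by a faithful action in each coordinate; a braid acting
    trivially is pure by [tbraid_diag]. *)
Lemma K_Psi n : (1 < n)%N -> K n = [set g | Psi 'Z_(2 * n) g = 1].
Proof.
move=> n1; have k1 : (1 < 2 * n)%N by lia.
have n2R : (2 * n%:R = 0 :> 'Z_(2 * n))%R.
  by rewrite -GRing.natrM; apply/eqP; rewrite (Zp_intr_eq0 (Posz _)).
have actM := dihedral_actM n2R.
apply/seteqP; split=> g /=.
  by move=> [Pg e]; rewrite (Psi_psi n2R) // e /= !(morph_one actM) perm3_1.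
move=> e; have Pg : PB3 g.
  have [t [p Pp gE]] := tbraid_decomp g.
  move: Pp; rewrite pure_genP => Pp.
  suff tE : t = Te by rewrite gE tE mulg1.
  have := Psi_psi n2R Pp; set q := perm3 _ _ _ => pE.
  have : Psi 'Z_(2 * n) (tbraid t) = q^-1.
    by rewrite -pE; apply: (mulgI (Psi 'Z_(2 * n) p)); rewrite mulgV -PsiM -gE.
  by rewrite perm3V => /tbraid_diag.
split=> //; move: e; rewrite (Psi_psi n2R) // -perm3_1 => /perm3_inj[].
case: (psi n g) => [[a b] d] /= /dihedral_act_inj-> // /dihedral_act_inj-> //.
by move=> /dihedral_act_inj->.
Qed.

(** * The hexagon relations for shifts *)

Section Hexagons.
Context (R : finComNzRingType).
Local Notation s1' := (act1 R).
Local Notation s2' := (act2 R).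
Local Notation x' := (Psi R x12).
Local Notation y' := (Psi R x23).
Implicit Types (h m : int) (b : bool).

Lemma zpow_expn (G : groupType) (g : G) k i : zpow (g ^+ k) i = zpow g (k%:Z * i)%R.
Proof. by rewrite zpowM. Qed.

Lemma act1_4 : s1' ^+ 4 = shift 4%:R%R 0%R 0%R.
Proof.
rewrite !expgSr expg0 mul1g; apply/permP => -[[a b] c].
by rewrite shiftE !permM !permE /act1_fun /=; congr (_, _, _); ring.
Qed.

Lemma act2_4 : s2' ^+ 4 = shift 0%R 4%:R%R 0%R.
Proof.
rewrite !expgSr expg0 mul1g; apply/permP => -[[a b] c].
by rewrite shiftE !permM !permE /act2_fun /=; congr (_, _, _); ring.
Qed.

(** The fourth power of [act1] is a shift, and [2 m + 1] is 1 or 3 modulo 4 according to the parity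
    [b] of [m = 2 h + b]. The next three formulas are obtained in the same way. *)
Lemma zpow_act1 h b v :
  zpow s1' (2 * (2 * h + b%:Z) + 1)%R v =
  (v.1.1 + 4 * h%:~R + (if b then 3 else 1), if b then - v.2 else v.2,
   if b then v.1.2 else - v.1.2)%R.
Proof.
have -> : (2 * (2 * h + b%:Z) + 1 = 4%:Z * h + (if b then 3%N else 1%N)%:Z)%R.
  by case: b => /=; ring.
rewrite zpowD -zpow_expn act1_4 zpow_shift permM shiftE /=.
case: b; rewrite !expgSr ?expg0 mul1g ?permM !permE /act1_fun /=;
  by congr (_, _, _); ring.
Qed.

Lemma zpow_act2 h b v :
  zpow s2' (2 * (2 * h + b%:Z) + 1)%R v =
  (if b then v.2 else - v.2 - 2, v.1.2 + 4 * h%:~R + (if b then 3 else 1),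
   if b then - v.1.1 - 2 else v.1.1)%R.
Proof.
have -> : (2 * (2 * h + b%:Z) + 1 = 4%:Z * h + (if b then 3%N else 1%N)%:Z)%R.
  by case: b => /=; ring.
rewrite zpowD -zpow_expn act2_4 zpow_shift permM shiftE /=.
case: b; rewrite !expgSr ?expg0 mul1g ?permM !permE /act2_fun /=;
  by congr (_, _, _); ring.
Qed.

Lemma zpow_Psi_x12 h b v :
  zpow x' (- (2 * h + b%:Z))%R v =
  (v.1.1 - 4 * h%:~R - (if b then 2 else 0), if b then - v.1.2 else v.1.2,
   if b then - v.2 else v.2)%R.
Proof.
have -> : x' = s1' ^+ 2 by rewrite /x12 !expg2 PsiM Psi_s1.
rewrite zpow_expn.
have -> : (2%:Z * - (2 * h + b%:Z) = 4%:Z * (- h - b%:Z) + (2 * b)%N%:Z)%R.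
  by case: b => /=; ring.
rewrite zpowD -zpow_expn act1_4 zpow_shift permM shiftE /=.
case: b; rewrite /= ?muln1 ?muln0 ?expg0 ?perm1 ?expg2 ?permM ?permE /act1_fun /=;
  by congr (_, _, _); ring.
Qed.

Lemma zpow_Psi_x23 h b v :
  zpow y' (- (2 * h + b%:Z))%R v =
  (if b then - v.1.1 - 2 else v.1.1, v.1.2 - 4 * h%:~R - (if b then 2 else 0),
   if b then - v.2 - 2 else v.2)%R.
Proof.
have -> : y' = s2' ^+ 2 by rewrite /x23 !expg2 PsiM Psi_s2.
rewrite zpow_expn.
have -> : (2%:Z * - (2 * h + b%:Z) = 4%:Z * (- h - b%:Z) + (2 * b)%N%:Z)%R.
  by case: b => /=; ring.
rewrite zpowD -zpow_expn act2_4 zpow_shift permM shiftE /=.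
case: b; rewrite /= ?muln1 ?muln0 ?expg0 ?perm1 ?expg2 ?permM ?permE /act2_fun /=;
  by congr (_, _, _); ring.
Qed.

(* This is - m / 2 or (m + 1) / 2, for m = 2 h + b. *)
Definition kappa h b : int := if b then (h + 1)%R else (- h)%R.

Let eq_of_subr (u v x y : R) : u = v -> (x - y = u - v)%R -> x = y.
Proof. by move=> ->; rewrite GRing.subrr => /eqP; rewrite GRing.subr_eq0 => /eqP. Qed.

Lemma hexagon1_shift (A B C : R) h b :
  let m := (2 * h + b%:Z)%R in let f := shift A B C in
  zpow s1' (2 * m + 1)%R * f^-1 * zpow s2' (2 * m + 1)%R * f =
    f^-1 * s1' * s2' * zpow x' (- m)%R <->
  B = (- A)%R /\ C = (4 * (kappa h b)%:~R)%R.
Proof.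
move=> m f; rewrite /f shiftV; split=> [/permP e|[-> ->]]; last first.
  apply/permP => -[[u v] w]; rewrite !permM zpow_act1 zpow_Psi_x12 shiftE.
  rewrite zpow_act2 !shiftE !permE /act1_fun /act2_fun /kappa /=.
  by case: b {m f} => /=; congr (_, _, _); ring.
(* The value at the origin suffices: its second coordinate determines [C], and then the first one
   gives [B = - A]. *)
have := e (0, 0, 0)%R; rewrite !permM zpow_act1 zpow_Psi_x12 shiftE.
rewrite zpow_act2 !shiftE !permE /act1_fun /act2_fun /kappa /=.
case: b {m f e} => /= -[e1 e2 e3].
  have eC : C = (4 * (h + 1)%:~R)%R by apply: (eq_of_subr (esym e2)); ring.
  by split=> //; rewrite eC in e1; apply: (eq_of_subr e1); ring.
have eC : C = (4 * (- h)%:~R)%R by apply: (eq_of_subr e2); ring.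
by split=> //; rewrite eC in e1; apply: (eq_of_subr e1); ring.
Qed.

Lemma hexagon2_shift (A : R) h b :
  let m := (2 * h + b%:Z)%R in
  let f := shift A (- A)%R (4 * (kappa h b)%:~R)%R in
  f^-1 * zpow s2' (2 * m + 1)%R * f * zpow s1' (2 * m + 1)%R =
    s2' * s1' * zpow y' (- m)%R * f.
Proof.
move=> m f; rewrite /f shiftV.
apply/permP => -[[u v] w]; rewrite !permM zpow_act1 zpow_Psi_x23 shiftE.
rewrite zpow_act2 !shiftE !permE /act1_fun /act2_fun /kappa /=.
by case: b {m f} => /=; congr (_, _, _); ring.
Qed.

(** With [f] of the form forced by the first hexagon, [t1] and [t2] are the intended images of [s1]
    and [s2] under [T]; this relation lets [braid_lift] define that homomorphism. *)
Lemma braid_shift (A : R) h b :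
  let m := (2 * h + b%:Z)%R in
  let f := shift A (- A)%R (4 * (kappa h b)%:~R)%R in
  let t1 := zpow s1' (2 * m + 1)%R in
  let t2 := f^-1 * zpow s2' (2 * m + 1)%R * f in
  t1 * t2 * t1 = t2 * t1 * t2.
Proof.
move=> m f t1 t2; rewrite /t2 /t1 /f shiftV.
apply/permP => -[[u v] w]; do 4!rewrite ?(permM, shiftE, zpow_act1, zpow_act2) /=.
by rewrite /kappa; case: b {m f t1 t2} => /=; congr (_, _, _); ring.
Qed.

End Hexagons.

(** * Parities in the images of [F2] and of its commutators *)

Definition oddz (i : int) : bool := odd `|i|%N.

Lemma oddzD i j : oddz (i + j)%R = oddz i (+) oddz j.
Proof. rewrite /oddz; lia. Qed.

Lemma oddzN i : oddz (- i)%R = oddz i.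
Proof. by rewrite /oddz abszN. Qed.

Lemma oddz_signM (e : bool) i : oddz ((-1) ^+ e * i)%R = oddz i.
Proof. by case: e; rewrite ?GRing.expr1 ?GRing.mulN1r ?oddzN // GRing.mul1r. Qed.

Lemma is_subgroup_F2 : is_subgroup F2.
Proof. exact: is_subgroup_gen. Qed.

Section FreeSubgroupImage.
Context (R : finComNzRingType).

(** The booleans [i] and [j] are the parities of the exponent sums of [x12] and [x23] in a word for
    [g]. Sign changes do not affect parities, so the invariants pass to products and inverses. *)
Lemma Psi_F2 g : F2 g -> exists (i j : bool) (k1 k2 k3 : int),
  [/\ oddz k1 = i (+) j, oddz k2 = j, oddz k3 = j &
      Psi R g = perm3 (affine j (2 * k1%:~R)%R) (affine i (2 * k2%:~R)%R)
        (affine (i (+) j) (2 * k3%:~R)%R)].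
Proof.
elim=> {g} [g [->|->]|||].
- exists true, false, 1%R, 0%R, 0%R; split=> //; rewrite Psi_x12.
  by congr (perm3 (affine _ _) (affine _ _) (affine _ _)); ring.
- exists false, true, (-1)%R, 1%R, (-1)%R; split=> //; rewrite Psi_x23.
  by congr (perm3 (affine _ _) (affine _ _) (affine _ _)); ring.
- exists false, false, 0%R, 0%R, 0%R; split=> //.
  by rewrite Psi1 !GRing.mulr0 affine1 perm3_1.
- move=> g h _ [i [j [k1 [k2 [k3 [o1 o2 o3 e]]]]]].
  move=> _ [i' [j' [k1' [k2' [k3' [o1' o2' o3' e']]]]]].
  exists (i (+) i'), (j (+) j'), ((-1) ^+ j' * k1 + k1')%R,
    ((-1) ^+ i' * k2 + k2')%R, ((-1) ^+ (i' (+) j') * k3 + k3')%R.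
  split; rewrite ?oddzD ?oddz_signM ?o1 ?o1' ?o2 ?o2' ?o3 ?o3' //.
    by rewrite addbACA.
  rewrite PsiM e e' perm3M !affineM addbACA {o1 o2 o3 o1' o2' o3' e e'}.
  by congr (perm3 (affine _ _) (affine _ _) (affine _ _));
    case: i' j' => -[] /=; ring.
- move=> g _ [i [j [k1 [k2 [k3 [o1 o2 o3 e]]]]]].
  exists i, j, (- ((-1) ^+ j * k1))%R, (- ((-1) ^+ i * k2))%R,
    (- ((-1) ^+ (i (+) j) * k3))%R.
  split; rewrite ?oddzN ?oddz_signM //.
  rewrite PsiV e perm3V !affineV {o1 o2 o3 e}.
  by congr (perm3 (affine _ _) (affine _ _) (affine _ _));
    case: i j => -[] /=; ring.
Qed.

Definition commutator (G : groupType) (g h : G) := g * h * (g^-1 * h^-1).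

Definition comm_shift (e d : bool) (k l : int) : int :=
  ((-1) ^+ e * (d%:Z * k) - (-1) ^+ d * (e%:Z * l))%R.

Lemma affine_commutator e d k l :
  commutator (affine e (2 * k%:~R)%R) (affine d (2 * l%:~R)%R) =
    affine false (4 * (comm_shift e d k l)%:~R)%R :> {perm R}.
Proof.
rewrite /commutator !affineV !affineM /comm_shift.
by case: e d => -[] /=; congr (affine _ _); ring.
Qed.

Lemma oddz_comm_shift e d k l :
  oddz (comm_shift e d k l) = (d && oddz k) (+) (e && oddz l).
Proof.
rewrite /comm_shift oddzD oddzN !oddz_signM.
by case: e d => -[]; rewrite ?GRing.mul1r ?GRing.mul0r.
Qed.

(** Integers are used because parity need not make sense for elements of [R]. *)
Definition even_shift (p : {perm R * R * R}) := exists a b c : int,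
  [/\ oddz a = oddz b, oddz b = oddz c &
      p = shift (4 * a%:~R)%R (4 * b%:~R)%R (4 * c%:~R)%R].

(** All three parities are that of [i j' + i' j], the determinant modulo 2 of the exponent sums of
    the two elements. *)
Lemma Psi_commutator g h : F2 g -> F2 h ->
  even_shift (commutator (Psi R g) (Psi R h)).
Proof.
move=> /Psi_F2[i [j [k1 [k2 [k3 [o1 o2 o3 e]]]]]].
move=> /Psi_F2[i' [j' [k1' [k2' [k3' [o1' o2' o3' e']]]]]].
exists (comm_shift j j' k1 k1'), (comm_shift i i' k2 k2'),
  (comm_shift (i (+) j) (i' (+) j') k3 k3'); split.
- rewrite !oddz_comm_shift o1 o1' o2 o2' {o1 o2 o3 o1' o2' o3' e e'}.
  by case: i j i' j' => -[] [] [].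
- rewrite !oddz_comm_shift o3 o3' o2 o2' {o1 o2 o3 o1' o2' o3' e e'}.
  by case: i j i' j' => -[] [] [].
- rewrite /shift -!affine_commutator e e' /commutator.
  by rewrite !perm3V !perm3M.
Qed.

Lemma even_shift1 : even_shift 1.
Proof.
by exists 0%R, 0%R, 0%R; split=> //; rewrite GRing.mulr0 shift0.
Qed.

Lemma even_shiftM p q : even_shift p -> even_shift q -> even_shift (p * q).
Proof.
move=> [a [b [d [o1 o2 ->]]]] [a' [b' [d' [o1' o2' ->]]]].
exists (a + a')%R, (b + b')%R, (d + d')%R; rewrite !oddzD o1 o2 o1' o2'.
by split=> //; rewrite shiftM; congr shift; ring.
Qed.

Lemma even_shiftV p : even_shift p -> even_shift p^-1.
Proof.
move=> [a [b [d [o1 o2 ->]]]]; exists (- a)%R, (- b)%R, (- d)%R.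
by rewrite !oddzN o1 o2; split=> //; rewrite shiftV; congr shift; ring.
Qed.

End FreeSubgroupImage.

(** * Cosets as fibres of [Psi], and the derived subgroup of the quotient of [F2] *)

Section DihedralQuotient.
Context (n : nat) (n1 : (1 < n)%N).
Local Notation R := 'Z_(2 * n).
Local Notation N := (NF2 (K n)).

Lemma left_coset_K g : left_coset g (K n) = [set h | Psi R h = Psi R g].
Proof.
rewrite (K_Psi n1); apply/seteqP; split=> [_ [h /= e <-]|h /= e].
  by rewrite PsiM e mulg1.
by exists (g^-1 * h); [rewrite /= PsiM PsiV e mulVg | rewrite mulVKg].
Qed.

Lemma left_coset_NF2 g : F2 g ->
  left_coset g N = [set h | F2 h /\ Psi R h = Psi R g].
Proof.
have [F1 FM FV] := is_subgroup_F2.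
move=> Fg; rewrite /NF2 (K_Psi n1); apply/seteqP; split=> [_ [h [/= e Fh] <-]|h /= [Fh e]].
  by split; [exact: FM | rewrite PsiM e mulg1].
exists (g^-1 * h); last by rewrite mulVKg.
by split; [rewrite /= PsiM PsiV e mulVg | apply: (FM) => //; exact: (FV)].
Qed.

Lemma NF2E : N = [set h | F2 h /\ Psi R h = 1].
Proof. by rewrite /NF2 (K_Psi n1) setIC. Qed.

(** The claim covers every representative of the coset, so that the induction can take apart
    products and inverses of cosets. *)
Lemma quotient_derived_shift A : quotient_derived F2 N A ->
  forall g, A g -> even_shift (Psi R g).
Proof.
elim=> {A} [_ [_ [g Fg <-] [_ [h Fh <-] <-]]||A B _ IHA _ IHB|A _ IHA] k.
- case=> _ [u + [v + <-]] [_ [u' [u0 + <-] [v' [v0 + <-] <-]] <-].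
  rewrite !left_coset_NF2 //= => -[_ eu] [_ ev] [_ eu0] [_ ev0].
  by rewrite !PsiM !PsiV eu ev eu0 ev0; exact: Psi_commutator.
- by rewrite NF2E => -[_ ->]; exact: even_shift1.
- by case=> u Au [v Bv <-]; rewrite PsiM; apply: even_shiftM; auto.
- by case=> u Au <-; rewrite PsiV; apply: even_shiftV; auto.
Qed.

(** Elements instead of cosets form a subgroup of [B3], to which [zpow_subgroup] applies. *)
Definition derived_rep : set B3 :=
  [set g | F2 g /\ quotient_derived F2 N (left_coset g N)].

Lemma is_subgroup_derived_rep : is_subgroup derived_rep.
Proof.
have [F1 FM FV] := is_subgroup_F2.
split=> [|g h [Fg Dg] [Fh Dh]|g [Fg Dg]]; split=> //; rewrite ?left_coset_NF2 //; auto.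
- rewrite Psi1 -NF2E; exact: generated1.
- have -> : [set k | F2 k /\ Psi R k = Psi R (g * h)] =
      Defs.coset_mul (left_coset g N) (left_coset h N).
    rewrite !left_coset_NF2 //; apply/seteqP; split=> [k /= [Fk e]|_ [u [Fu eu] [v [Fv ev] <-]]].
      exists g; first by [].
      exists (g^-1 * k); last by rewrite mulVKg.
      split; first by apply: (FM) => //; exact: (FV).
      by rewrite PsiM PsiV e PsiM mulKg.
    by split; [exact: FM | rewrite !PsiM eu ev].
  exact: generatedM.
- have -> : [set k | F2 k /\ Psi R k = Psi R g^-1] = Defs.coset_inv (left_coset g N).
    rewrite left_coset_NF2 //; apply/seteqP; split=> [k /= [Fk e]|_ [u [Fu eu] <-]].
      exists k^-1; last by rewrite invgK.
      by split; [exact: (FV) | rewrite PsiV e PsiV invgK].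
    by split; [exact: (FV) | rewrite !PsiV eu].
  exact: generatedV.
Qed.

Lemma commutator_derived_rep g h : F2 g -> F2 h -> derived_rep (commutator g h).
Proof.
have [F1 FM FV] := is_subgroup_F2; move=> Fg Fh.
have Fgh : F2 (commutator g h) by apply: (FM); apply: (FM) => //; exact: (FV).
split=> //; apply: generated_in; exists (left_coset g N); first by exists g.
exists (left_coset h N); first by exists h.
rewrite /coset_comm !left_coset_NF2 //.
apply/seteqP; split=> [_ [_ [u [Fu eu] [v [Fv ev] <-]] [_ [_ [u' [Fu' eu'] <-] [_ [v' [Fv' ev'] <-] <-]] <-]]|k /= [Fk e]].
  split; first by do !apply: (FM) => //; exact: (FV).
  by rewrite !PsiM !PsiV eu ev eu' ev'.
have Fw : F2 (h^-1 * g^-1 * k * h).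
  by do !apply: (FM) => //; exact: (FV).
(* The first three factors are [g], [h] and [g^-1]; the fourth absorbs the rest of [k] and has the
   same image under [Psi] as [h^-1]. *)
exists (g * h); first by exists g => //; exists h.
exists (h^-1 * g^-1 * k); last by rewrite !mulgA mulgK mulgV mul1g.
exists g^-1; first by exists g.
exists (g * (h^-1 * g^-1 * k)); last by rewrite mulKg.
exists (g * (h^-1 * g^-1 * k))^-1; last by rewrite invgK.
split; first by apply: (FV); do !apply: (FM) => //; exact: (FV).
rewrite PsiV !PsiM !PsiV e /commutator !PsiM !PsiV.
by rewrite !invgM !invgK !mulgA !mulgVK mulgK.
Qed.

End DihedralQuotient.

(** * Arithmetic of coprime integers *)

(** The witness is the part of [q] prime to [a]. A prime of [q] dividing [a] divides neither [b] nor
    the witness; any other prime of [q] divides the witness but not [a]. *)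
Lemma coprimez_translate (a b : int) (q : nat) : (0 < q)%N -> coprimez a b ->
  exists j : int, coprimez (a + b * j)%R (Posz q).
Proof.
move=> q0 ab; pose pi := [pred p : nat | ~~ (p %| `|a|)%N].
have q_pi0 : (0 < partn q pi)%N by exact: part_gt0.
exists (Posz (partn q pi)); rewrite coprimezE /coprime.
set A := `|_|%N; have [//|nc] := eqVneq (gcdn A q) 1%N.
have g1 : (1 < gcdn A q)%N by rewrite ltn_neqAle eq_sym nc gcdn_gt0 q0 orbT.
have pp := pdiv_prime g1; have := pdiv_dvd (gcdn A q).
move: (pdiv _) pp => p pp; rewrite dvdn_gcd => /andP[pA pq].
have {}pA : (Posz p %| (a + b * Posz (partn q pi))%R)%Z by rewrite dvdzE.
have [pa|pa] := boolP (p %| `|a|)%N.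
  move: pA; rewrite GRing.rpredDl ?dvdzE // -?dvdzE dvdzE abszM Euclid_dvdM //= => /orP[pb|pj].
    have : (p %| gcdn `|a| `|b|)%N by rewrite dvdn_gcd pa.
    move: ab; rewrite coprimezE => /eqP->; rewrite dvdn1 => /eqP p1.
    by rewrite p1 in pp.
  have : p \in pi.
    by apply: pnatPpi (part_pnat pi q) _; rewrite mem_primes pp q_pi0.
  by rewrite inE pa.
have pj : (p %| partn q pi)%N.
  have pid : partn p pi = p by rewrite part_pnat_id // pnatE.
  by rewrite -pid partn_dvd.
move: pA; rewrite GRing.rpredDr; first by rewrite dvdzE (negPf pa).
by apply: dvdz_mull; rewrite dvdzE.
Qed.

Lemma coprimez_odd_mul4 (m : int) (n : nat) :
  coprimez (2 * m + 1)%R (Posz n) -> coprimez (2 * m + 1)%R (4 * Posz n)%R.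
Proof.
move=> en; rewrite coprimezMr en andbT coprimezE (@coprime_pexpr 2 _ 2) // coprimen2.
lia.
Qed.

(** This form of the Bezout identity recovers [act1] from its [e]-th power, since over [Z/2n] the
    [4 n]-th power of [act1] is trivial. *)
Lemma inverse_mod4 (e : int) (n : nat) : coprimez e (4 * Posz n)%R ->
  exists u w : int, (e * u = 1 + 4%:Z * (Posz n * w))%R.
Proof.
move=> /coprimezP[[u v] /= uv]; exists u, (- v)%R.
by transitivity (u * e + v * (4 * Posz n) - v * (4 * Posz n))%R; [|rewrite uv]; ring.
Qed.

(** * Shifts generated by conjugates, and bounds for [Nord] *)

Section ConjugateSquares.
Context (R : finComNzRingType) (A B C : R).
Let E := (shift A B C)^-1 * act2 R * shift A B C.

Let E2 : E ^+ 2 = perm3 (affine true (2 * A - 2)%R) (affine false 2%R)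
  (affine true (2 * C - 2)%R).
Proof.
have -> : E ^+ 2 = (shift A B C)^-1 * Psi R x23 * shift A B C.
  by rewrite /x23 !expg2 PsiM Psi_s2 /E !mulgA mulgK.
rewrite Psi_x23 shiftV /shift !perm3M !affineM.
by congr (perm3 (affine _ _) (affine _ _) (affine _ _)) => /=; ring.
Qed.

Lemma conj_act2_4 : E ^+ 4 = shift 0%R 4%:R%R 0%R.
Proof.
rewrite (expgM E 2 2) E2 expg2 perm3M !affineM.
by congr (perm3 (affine _ _) (affine _ _) (affine _ _)) => /=; ring.
Qed.

(** The product of the two squares is a reflection in the first two coordinates, which squaring
    kills, and a translation in the third. *)
Lemma act1_conj_act2_4 :
  (act1 R ^+ 2 * E ^+ 2) ^+ 2 = shift 0%R 0%R (4 * (C - 1))%R.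
Proof.
have -> : act1 R ^+ 2 = Psi R x12 by rewrite /x12 !expg2 PsiM Psi_s1.
rewrite E2 Psi_x12 perm3M expg2 perm3M !affineM.
by congr (perm3 (affine _ _) (affine _ _) (affine _ _)) => /=; ring.
Qed.

End ConjugateSquares.

Section KernelOrders.
Context (n : nat) (n1 : (1 < n)%N).
Local Notation R := 'Z_(2 * n).

Lemma perm3X (S : finComNzRingType) (p1 p2 p3 : {perm S}) k :
  perm3 p1 p2 p3 ^+ k = perm3 (p1 ^+ k) (p2 ^+ k) (p3 ^+ k).
Proof.
elim: k => [|k IH]; first by rewrite !expg0 perm3_1.
by rewrite !expgSr IH perm3M.
Qed.

Lemma intr_eq_dvd (i j : int) : (i%:~R = j%:~R :> R)%R <-> (Posz (2 * n) %| (i - j)%R)%Z.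
Proof.
rewrite -Zp_intr_eq0; last by lia.
by rewrite GRing.rmorphB GRing.subr_eq0; split=> /eqP.
Qed.

Lemma Psi_expn g k : Psi R (g ^+ k) = Psi R g ^+ k.
Proof. exact: (Psi_zpow R g (Posz k)). Qed.

Lemma dvdn_Nord : n %| Nord (K n).
Proof.
apply: dvdn_trans (dvdn_lcml _ _); apply: dvdn_trans (dvdn_lcml _ _).
(* In the infinite case the default order 0 is divisible by [n]; otherwise the first coordinate, a
   translation by 2, bounds the order. *)
rewrite /coset_order; case: pselect => [ex|_] //.
case: ex_minnP => k /andP[_ /asboolP/(left_coset_id _ (is_subgroup_K n))] + _.
rewrite (K_Psi n1) /= Psi_expn Psi_x12 perm3X -perm3_1 => /perm3_inj[e _ _].
move: e; rewrite affine_expn => /permP/(_ 0%R).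
rewrite permE perm1 /affine_fun GRing.mulr0 GRing.add0r => e.
have /intr_eq_dvd : ((Posz (2 * k))%:~R = (0 : int)%:~R :> R)%R.
  by rewrite -[LHS]/((2 * k)%:R)%R GRing.natrM e.
by rewrite GRing.subr0 dvdzE /= dvdn_pmul2l.
Qed.

(** The [2 n]-th power of [x12] is the [n]-th power of [s1 ^+ 4], a shift by [4 n], hence trivial
    modulo [2 n]; the same holds for [x23], and [c] acts trivially. *)
Lemma Nord_dvd : Nord (K n) %| 2 * n.
Proof.
have n4 : (4%:R * (Posz n)%:~R = 0 :> R)%R.
  have /intr_eq_dvd e : (Posz (2 * n) %| ((4 * Posz n) - 0)%R)%Z.
    by apply/dvdzP; exists 2%:R%R; lia.
  by transitivity ((4 * Posz n)%:~R : R)%R; [ring | rewrite e].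
have ord g : Psi R g ^+ (2 * n) = 1 -> coset_order g (K n) %| 2 * n.
  move=> e; apply: (coset_order_dvd (is_subgroup_K n)).
  by rewrite (K_Psi n1) /= Psi_expn.
rewrite /Nord !dvdn_lcm; apply/andP; split; first (apply/andP; split); apply: ord.
- have -> : x12 = s1 ^+ 2 by [].
  rewrite Psi_expn Psi_s1 -expgM mulnA expgM act1_4.
  by rewrite -[LHS]/(zpow _ (Posz n)) zpow_shift n4 !GRing.mul0r shift0.
- have -> : x23 = s2 ^+ 2 by [].
  rewrite Psi_expn Psi_s2 -expgM mulnA expgM act2_4.
  by rewrite -[LHS]/(zpow _ (Posz n)) zpow_shift n4 !GRing.mul0r shift0.
- by rewrite Psi_c expg1n.
Qed.

End KernelOrders.

(** * Shadows built from shifts *)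

Section ShiftShadows.
Context (n : nat) (n1 : (1 < n)%N).
Local Notation R := 'Z_(2 * n).
Variables (h : int) (b : bool) (a : int) (f : B3).
Let m := (2 * h + b%:Z)%R.
Let e := (2 * m + 1)%R.
Hypothesis Psi_f : Psi R f =
  shift (4 * a%:~R)%R (- (4 * a%:~R))%R (4 * (kappa h b)%:~R)%R.
Hypothesis coprime_e : coprimez e (Posz n).

Lemma shift_hexagons : hexagons (K n) m f.
Proof.
rewrite /hexagons !left_coset_K // !PsiM !PsiV !Psi_zpow Psi_c Psi_s1 Psi_s2.
have -> : zpow 1 m = 1 :> {perm R * R * R}.
  by apply: (zpow_uniq (p := fun=> 1)) => // j; rewrite mulg1.
rewrite !mulg1 Psi_f; split.
  have [_ hex1] := hexagon1_shift (4 * a%:~R : R)%R (- (4 * a%:~R))%R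
    (4 * (kappa h b)%:~R)%R h b.
  by rewrite hex1.
by rewrite hexagon2_shift.
Qed.

Let t1 := zpow (act1 R) e.
Let t2 := (Psi R f)^-1 * zpow (act2 R) e * Psi R f.

Let t_braid : t1 * t2 * t1 = t2 * t1 * t2.
Proof. by rewrite /t1 /t2 Psi_f braid_shift. Qed.

Let lift := braid_lift t1 t2.
Let liftM : {morph lift : x y / x * y} := braid_liftM t_braid.

Let lift_in_Psi g : exists k, Psi R k = lift g.
Proof.
apply: (@B3_gen [set g | exists k, Psi R k = lift g]); first split.
- by exists 1; rewrite Psi1 morph_one.
- by move=> u v [u' eu] [v' ev]; exists (u' * v'); rewrite PsiM eu ev liftM.
- by move=> u [u' eu]; exists u'^-1; rewrite PsiV eu (morph_inv _ liftM).
- by exists (zpow s1 e); rewrite Psi_zpow Psi_s1 /lift braid_lift_s1.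
- exists (f^-1 * zpow s2 e * f).
  by rewrite !PsiM PsiV Psi_zpow Psi_s2 /lift braid_lift_s2.
Qed.

Let lift_image : set {perm R * R * R} := [set p | exists k, lift k = p].

Let is_subgroup_lift_image : is_subgroup lift_image.
Proof.
split=> [|_ _ [u <-] [v <-]|_ [u <-]].
- by exists 1; exact: morph_one liftM.
- by exists (u * v); exact: liftM.
- by exists u^-1; exact: morph_inv liftM.
Qed.

Let zero4n w : (4%:R * (Posz n * w)%:~R = 0 :> R)%R.
Proof.
have /intr_eq_dvd e4 : (Posz (2 * n) %| ((4 * (Posz n * w)) - 0)%R)%Z.
  by apply/dvdzP; exists (2 * w)%R; lia.
by transitivity ((4 * (Posz n * w))%:~R : R)%R; [ring | rewrite e4].
Qed.

(* The image of lift contains act1 and E := f^-1 act2 f; the elements act1^4, E^4 and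
   (act1^2 E^2)^2 are the shifts by (4, 0, 0), (0, 4, 0) and
   (0, 0, -4 (1 - 4 kappa)), where 1 - 4 kappa = +- e is invertible, so it also
   contains f. *)
Let Psi_in_lift g : exists k, lift k = Psi R g.
Proof.
have [_ IM IV] := is_subgroup_lift_image.
have IZ p i := @zpow_subgroup _ _ p i is_subgroup_lift_image.
have It1 : lift_image t1 by exists s1; exact: braid_lift_s1.
have It2 : lift_image t2 by exists s2; exact: braid_lift_s2.
have [u [w uE]] := inverse_mod4 (coprimez_odd_mul4 coprime_e).
have I1 : lift_image (act1 R).
  suff <- : zpow t1 u = act1 R by exact: IZ.
  rewrite /t1 -zpowM uE zpowD -(zpow_expn _ 4) act1_4 zpow_shift zero4n.
  by rewrite !GRing.mul0r shift0 mulg1.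
have zE : zpow (act2 R) (e * u)%R = act2 R.
  rewrite uE zpowD -(zpow_expn _ 4) act2_4 zpow_shift zero4n.
  by rewrite !GRing.mul0r shift0 mulg1.
pose E := (Psi R f)^-1 * act2 R * Psi R f.
have I2 : lift_image E.
  suff <- : zpow t2 u = E by exact: IZ.
  rewrite /E -{}zE zpowM /t2; apply/esym.
  pose conj p := (Psi R f)^-1 * p * Psi R f.
  apply: (@zpow_morph _ _ conj) => p q.
  by rewrite /conj !mulgA mulgK.
have E4 : E ^+ 4 = shift 0%R 4%:R%R 0%R by rewrite /E Psi_f conj_act2_4.
have W := act1_conj_act2_4 (4 * a%:~R : R)%R (- (4 * a%:~R))%R
  (4 * (kappa h b)%:~R)%R.
rewrite -Psi_f -/E in W.
have IX p k : lift_image p -> lift_image (p ^+ k) by exact: IZ (Posz k).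
(* As [4 kappa - 1] is [e] or [- e] according to [b], this [j] solves [(4 kappa - 1) j = kappa]
   modulo [4 n]. *)
pose j := (if b then u * kappa h b else - (u * kappa h b))%R.
have fE : Psi R f = zpow (act1 R ^+ 4) a * zpow (E ^+ 4) (- a)%R *
    zpow ((act1 R ^+ 2 * E ^+ 2) ^+ 2) j.
  rewrite E4 W act1_4 !zpow_shift !shiftM Psi_f; congr shift; [ring|ring|].
  have jE : ((4 * kappa h b - 1) * j = kappa h b + 4 * (Posz n * (w * kappa h b)))%R.
    transitivity (e * u * kappa h b)%R; last by rewrite uE; ring.
    by rewrite /e /m /j /kappa; case: (b) => /=; ring.
  transitivity (4%:R * ((4 * kappa h b - 1) * j)%:~R : R)%R; last by ring.
  have := zero4n (4 * (w * kappa h b))%R; rewrite jE => z.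
  by rewrite -[LHS]GRing.addr0 -z; ring.
have If : lift_image (Psi R f).
  rewrite fE; apply: (IM); [apply: (IM)|]; apply: IZ; do ?apply: (IX) => //.
  by apply: (IM); exact: (IX).
apply: (@B3_gen [set g | lift_image (Psi R g)]); first split.
- by exists 1; rewrite Psi1; exact: morph_one liftM.
- by move=> p q Ip Iq; rewrite /= PsiM; exact: IM.
- by move=> p Ip; rewrite /= PsiV; exact: IV.
- by rewrite /= Psi_s1.
- rewrite /= Psi_s2; have -> : act2 R = Psi R f * E * (Psi R f)^-1.
    by rewrite /E !mulgA mulgV mul1g mulgK.
  by apply: (IM); [exact: (IM) | exact: (IV)].
Qed.

(** The coset [T g] is the fibre of [Psi] over [lift g]: it is nonempty by [lift_in_Psi], and every
    coset occurs by [Psi_in_lift]. *)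
Lemma shift_T_surj : exists2 T, is_T (K n) m f T &
  set_surj [set: B3] (quotient_set [set: B3] (K n)) T.
Proof.
exists (fun g => [set k | Psi R k = lift g]).
  split.
  - move=> g; have [k <-] := lift_in_Psi g.
    by exists k => //; rewrite left_coset_K.
  - move=> u v; apply/seteqP; split=> [k /= ek|_ [u' /= eu [v' /= ev <-]]].
      have [u' eu] := lift_in_Psi u; exists u' => //; exists (u'^-1 * k).
        by rewrite /= PsiM PsiV eu ek liftM mulKg.
      by rewrite mulVKg.
    by rewrite PsiM eu ev liftM.
  - by rewrite left_coset_K // Psi_zpow Psi_s1 /lift braid_lift_s1.
  - by rewrite left_coset_K // !PsiM PsiV Psi_zpow Psi_s2 /lift braid_lift_s2.
move=> _ [g _ <-]; have [k ek] := Psi_in_lift g.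
by exists k => //; rewrite left_coset_K // ek.
Qed.

Lemma shift_is_GT_pair : derived_rep n f -> is_GT_pair (K n) m f.
Proof.
move=> [Ff Df]; split=> //; [exact: shift_hexagons| |exact: shift_T_surj].
have e4n := coprimez_odd_mul4 coprime_e.
have : coprime `|e| (2 * (2 * n)).
  by move: e4n; rewrite coprimezE abszM mulnA.
by rewrite coprimeMr => /andP[_ /(coprime_dvdr (Nord_dvd n1))]; rewrite coprimezE.
Qed.

End ShiftShadows.

(* The exponents of the two commutators are chosen so that their shifts
   (4, -4, -4) and (4, -4, 4) add up to (4a, -4a, 4d). *)
Lemma derived_rep_exists (a d : int) : oddz a = oddz d -> exists2 f : B3,
  forall n, (1 < n)%N -> derived_rep n f &
  forall R : finComNzRingType,
    Psi R f = shift (4 * a%:~R)%R (- (4 * a%:~R))%R (4 * d%:~R)%R.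
Proof.
move=> ad; have [t tE] : exists t, (a + d = 2 * t)%R.
  exists ((a + d) %/ 2)%Z; have := oddzD a d; rewrite ad addbb /oddz; lia.
have [F1 FM FV] := is_subgroup_F2.
have F12 : F2 x12 by apply: generated_in; left.
have F23 : F2 x23 by apply: generated_in; right.
exists (zpow (commutator x12 x23) (a - t)%R *
        zpow (commutator x23^-1 x12^-1) t) => [n n1|R].
  have sD := is_subgroup_derived_rep n1; have [_ DM _] := sD.
  by apply: DM; apply: zpow_subgroup => //; apply: commutator_derived_rep => //;
    exact: FV.
have comm g h : Psi R (commutator g h) = commutator (Psi R g) (Psi R h).
  by rewrite /commutator !PsiM !PsiV.
have U : Psi R (commutator x12 x23) = shift 4%:R%R (- 4%:R)%R (- 4%:R)%R.
  rewrite comm Psi_x12 Psi_x23 /commutator !perm3V !affineV !perm3M !affineM.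
  by congr (perm3 (affine _ _) (affine _ _) (affine _ _)) => /=; ring.
have W : Psi R (commutator x23^-1 x12^-1) = shift 4%:R%R (- 4%:R)%R 4%:R%R.
  rewrite comm !PsiV Psi_x12 Psi_x23 /commutator !perm3V !affineV !perm3M !affineM.
  by congr (perm3 (affine _ _) (affine _ _) (affine _ _)) => /=; ring.
rewrite PsiM !Psi_zpow U W !zpow_shift shiftM.
have -> : d = (2 * t - a)%R by rewrite -tE; ring.
by congr shift; ring.
Qed.

(** * Integral data of a shadow, and its lift *)

(** The derived subgroup condition yields the integers, the first hexagon relates them. The common
    parity of [a] and [d] is recorded because [Psi f] does not determine it unless 4 divides [n]. *)
Lemma GT_pair_shift n m f : (1 < n)%N -> is_GT_pair (K n) m f ->
  exists (h : int) (b : bool) (a d : int), [/\ m = (2 * h + b%:Z)%R, oddz a = oddz d,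
    (Posz n %| (2 * (d - kappa h b))%R)%Z,
    coprimez (2 * m + 1)%R (Posz n) &
    Psi 'Z_(2 * n) f = shift (4 * a%:~R)%R (- (4 * a%:~R))%R (4 * d%:~R)%R].
Proof.
move=> n1 [Ff [hex _] cop Df _].
have fN : left_coset f (NF2 (K n)) f by rewrite left_coset_NF2.
have [a [a' [d [aa' a'd fE]]]] := quotient_derived_shift n1 Df fN.
pose b := oddz m; have [h mE] : exists h, m = (2 * h + b%:Z)%R.
  exists ((m - b%:Z) %/ 2)%Z; rewrite /b /oddz; lia.
have {}hex : Psi 'Z_(2 * n) (zpow s1 (2 * m + 1)%R * f^-1 * zpow s2 (2 * m + 1)%R * f) =
    Psi 'Z_(2 * n) (f^-1 * s1 * s2 * zpow x12 (- m)%R * zpow c m).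
  move: hex; rewrite !left_coset_K // => /seteqP[sub _]; exact: sub.
move: hex; rewrite !PsiM !PsiV !Psi_zpow Psi_c Psi_s1 Psi_s2 fE.
have -> : zpow 1 m = 1 :> {perm 'Z_(2 * n) * 'Z_(2 * n) * 'Z_(2 * n)}.
  by apply: (zpow_uniq (p := fun=> 1)) => // j; rewrite mulg1.
rewrite mulg1 mE => /hexagon1_shift[a'E dE].
exists h, b, a, d; split=> //.
- by rewrite aa'.
- have /(intr_eq_dvd n1) : ((4 * d)%:~R = (4 * kappa h b)%:~R :> 'Z_(2 * n))%R.
    by rewrite !intrM dE.
  by move=> /dvdzP[w wE]; apply/dvdzP; exists w; lia.
- move: cop; rewrite -mE !coprimezE; apply: coprime_dvdr; exact: dvdn_Nord.
- by rewrite a'E.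
Qed.

Lemma residue_class_translate m (d k : nat) (j : int) : (d %| k)%N ->
  residue_class (m + Posz k * j)%R d = residue_class m d.
Proof.
move=> /dvdnP[w ->]; apply/seteqP; split=> _ [i _ <-].
  by exists (Posz w * j + i)%R => //; rewrite PoszM; ring.
by exists (i - Posz w * j)%R => //; rewrite PoszM; ring.
Qed.

Theorem theorem4p4 (n q : nat) (n_ge3 : (3 <= n)%N) (q_ge3 : (3 <= q)%N)
    (Kqn : K q `<=` K n) :
  set_surj (GT (K q)) (GT (K n)) (reduction (K n)).
Proof.
have n1 : (1 < n)%N by exact: ltnW.
have q1 : (1 < q)%N by exact: ltnW.
move=> _ [m [f [GTf ->]]].
have Ff : F2 f by case: GTf.
have [h [b [a [d [mE ad dk cop fE]]]]] := GT_pair_shift n1 GTf.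
(* Moving [m] by multiples of [2 n] preserves its class modulo [Nord (K n)] and moves [2 m + 1] by
   multiples of [4 n], whence the factor 4. *)
have [j cop'] := coprimez_translate (ltnW q1) (coprimez_odd_mul4 cop).
(* Taking [d'] equal to [kappa h' b] as an integer gives the hexagons modulo [2 q]. The correction
   [d' - d] gives [a'] the parity of [d'] without changing [4 a] modulo [2 n]. *)
pose h' := (h + Posz n * j)%R; pose d' := kappa h' b; pose a' := (a + d' - d)%R.
have dd' : (Posz n %| (2 * (d' - d))%R)%Z.
  have [w wE] := dvdzP dk; apply/dvdzP.
  (* [kappa h' b - kappa h b] is [n j] or [- n j] according to [b], and [w] accounts for
     [d - kappa h b]. *)
  exists ((if b then 2 * j else - (2 * j)) - w)%R.
  rewrite GRing.mulrBl -wE /d' /kappa /h'; case: (b); ring.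
have ad' : oddz a' = oddz d'.
  by rewrite /a' !oddzD oddzN ad addbC addKb.
have [f' Df' f'E] := derived_rep_exists ad'.
have m'E : (m + Posz (2 * n) * j = 2 * h' + b%:Z)%R.
  by rewrite mE /h' PoszM; ring.
exists (GTclass (K q) (m + Posz (2 * n) * j)%R f').
  exists (m + Posz (2 * n) * j)%R, f'; split=> //; rewrite m'E.
  apply: (shift_is_GT_pair q1 (f'E _)); last exact: Df'.
  by rewrite -m'E; congr coprimez: cop'; rewrite PoszM; ring.
rewrite (reduction_class _ _ (is_subgroup_K q) (is_subgroup_K n) Kqn) /GTclass.
rewrite residue_class_translate; last exact: Nord_dvd.
have [Ff' _] := Df' n n1.
(* Both cosets are fibres of [Psi] on [F2], so it is enough to compare two shifts modulo [2 n]. *)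
rewrite !left_coset_NF2 //; suff -> : Psi 'Z_(2 * n) f' = Psi 'Z_(2 * n) f by [].
have e4 (u v : int) : (Posz n %| (2 * (u - v))%R)%Z ->
    (4 * u%:~R = 4 * v%:~R :> 'Z_(2 * n))%R.
  move=> /dvdzP[w wE].
  suff : ((4 * u)%:~R = (4 * v)%:~R :> 'Z_(2 * n))%R by rewrite !intrM.
  by apply/(intr_eq_dvd n1)/dvdzP; exists w; lia.
rewrite f'E fE (e4 a' a); last by rewrite (_ : _ - _ = d' - d)%R // /a'; ring.
by rewrite (e4 d' d).
Qed.
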